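(* Let $\mathbf{G}\in\mathbb{R}^{m\times n}$ with $m\ge n$, let $P$ processors be arranged in a $\sqrt{\frac{mP}{nc}}\times\sqrt{\frac{nP}{mc}}\times c$ grid with replication factor $1\le c\le\left(\frac nm P\right)^{1/3}$, let $\mu$ be a batching parameter with $c\le\mu\le\sqrt{\frac{nP}{mc}}$, and let $\eta\in\left[2\mu/\sqrt{\frac{mcP}{n}},\,1\right]$ be a utilization factor. Assume that $O(1)$ sweeps of 2D parallel Jacobi are applied to each subproblem. Then one sweep of 2.5D parallel Jacobi SVD (the algorithm described in the context) has complexity $$\alpha\cdot O\!\left(X\sqrt[4]{\frac nm}\,\log\!\left(\eta\mu\sqrt{\frac{mcP}{n}}\right)+\frac{\sqrt{mP/(nc)}}{\mu}\log\!\left(\frac{\sqrt{mP/(nc)}}{\mu}\right)\right)+\beta\cdot O\!\left(\frac{\sqrt[4]{mn^7}}{X}+\sqrt{\frac{mn^3}{cP}}\right)+\gamma\cdot O\!\left(\frac{\sqrt{mn^5}}{X^2}+\frac{mn^2}{P}\right),$$ where $X=\sqrt[4]{\dfrac{\eta^2P^3}{\mu^2c}}$.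
   Context: **Cost model.** For a parallel algorithm on $P$ distributed-memory processors, $S$ is the number of messages sent along the critical path (longest chain of serially dependent operations), $W$ the maximum number of words communicated by any processor along it, $F$ the maximum number of flops performed by any processor along it; the cost is $\alpha S+\beta W+\gamma F$, with $\alpha,\beta,\gamma$ the times per message, word and flop. ''Complexity $\alpha\cdot O(f)+\beta\cdot O(g)+\gamma\cdot O(h)$'' means $S=O(f)$, $W=O(g)$, $F=O(h)$. Communication and computation do not overlap on a processor; there is no contention. Sending $w$ words point-to-point costs $O(1)$ messages and $O(w)$ words. Collectives involving $p$ processors and $w\ge p$ words cost: scatter or gather $\alpha\log_2p+\beta w$; broadcast $2\alpha\log_2p+2\beta w$; reduce $2\alpha\log_2p+2\beta w+\gamma w$. Local $k\times k$ matrix multiplication and symmetric diagonalization cost $O(k^3)$ flops. All quantities that need to be integers (grid dimensions, block sizes, numbers of groups) are assumed to be integers. **Subroutine: 2.5D matrix multiplication.** It multiplies two $N\times N$ matrices, initially block-distributed on the top layer of a $\sqrt{p/c}\times\sqrt{p/c}\times c$ grid of $p$ processors ($1\le c\le p^{1/3}$), by replicating the inputs to all $c$ layers, letting each layer carry out a $1/c$ fraction of the steps of Cannon's algorithm, and sum-reducing to the top layer. Its known complexity (Solomonik–Demmel) is $\alpha\cdot O(\sqrt{p/c^3}+\log c)+\beta\cdot O(N^2/\sqrt{cp})+\gamma\cdot O(N^3/p)$. **Index list.** For an integer $q$, the anti-diagonal list on $q$ indices consists of $q$ groups; for $K=0,\dots,q-1$ the group consists of all pairs $(I,J)$, $1\le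 I<J\le q$, with $I+J\equiv K\pmod q$. Pairs within a group are disjoint. **Subroutine: one sweep of 2D parallel Jacobi** on a symmetric $N\times N$ matrix $\mathbf{M}$ and orthogonal $\mathbf{Q}$, both distributed in $\hat b\times\hat b$ blocks, $\hat b=N/\sqrt p$, on a $\sqrt p\times\sqrt p$ grid (one block of each per processor $(I,J)$). Groups of the anti-diagonal list on $\sqrt p$ indices are processed serially; for each group all pairs $(I,J)$ are processed in parallel: processors $(I,I)$ and $(J,J)$ send their diagonal blocks to $(I,J)$, which locally diagonalizes the $2\hat b\times2\hat b$ matrix $\mathbf{M}([I,J],[I,J])=\mathbf{V}\mathbf{D}\mathbf{V}^T$ and sends the needed $\hat b\times\hat b$ blocks of $\mathbf{V},\mathbf{D}$ to $(I,I),(J,J),(J,I)$; $\mathbf{M}([I,J],[I,J])$ is overwritten by $\mathbf{D}$; processors in block rows $I,J$ (and block columns $I,J$) pairwise exchange their blocks of $\mathbf{M}$ (and of $\mathbf{Q}$, for columns); $(I,I)$ and $(J,J)$ each broadcast two $\hat b\times\hat b$ blocks of $\mathbf{V}$ along their row and column; then each processor in block rows/columns $I,J$ updates its blocks locally, so that block rows $I,J$ of $\mathbf{M}$ are multiplied on the left by $\mathbf{V}^T$, and block columns $I,J$ of $\mathbf{M}$ and $\mathbf{Q}$ on the right by $\mathbf{V}$. **Layout for the SVD.** Processors are $\mathrm{Proc}\langle p,q,r\rangle$, $1\le p\le\sqrt{mP/(nc)}$, $1\le q\le\sqrt{nP/(mc)}$, $1\le r\le c$; $r=1$ is the top layer.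 Let $b=\sqrt{mnc/P}$ and $B=\mu b$. On the top layer each processor owns one $b\times b$ block (fine tile) of $\mathbf{G}$. For $1\le I\le m/B$, $1\le J\le n/B=\sqrt{nP/(mc)}/\mu$, the coarse tile $\mathbf{G}_{IJ}=\mathbf{G}((I-1)B+1:IB,(J-1)B+1:JB)$ is distributed over $\mathrm{ProcTile}(I,J,1)$, where $\mathrm{ProcTile}(I,J,k)=\{\mathrm{Proc}\langle p,q,k\rangle:(I-1)\mu+1\le p\le I\mu,\ (J-1)\mu+1\le q\le J\mu\}$. $\mathbf{G}_J=\mathbf{G}(:,(J-1)B+1:JB)$ is the $J$-th coarse column. The $n\times n$ orthogonal matrix $\mathbf{V}$ of accumulated right singular vectors is stored likewise, $\mathbf{V}_{KJ}$ on $\mathrm{ProcTile}(K,J,1)$ for $1\le K,J\le n/B$. $\mathrm{ProcSlab}(\cdot,\cdot,\cdot)$ denotes the union of the tiles whose indices lie in the given lists ('':'' meaning all). Communication between coarse processor tiles is performed between individual processors occupying the same position within each tile. **One sweep of 2.5D parallel Jacobi SVD (one-sided).** The groups $g$ of the anti-diagonal list on $\sqrt{nP/(mc)}/\mu$ indices are processed serially; for each $g$, all $(I,J)\in g$ are processed in parallel: 1. For all $K=1,\dots,m/B$ in parallel: $\mathrm{ProcTile}(K,I,1)$ and $\mathrm{ProcTile}(K,J,1)$ exchange $\mathbf{G}_{KI}\leftrightarrow\mathbf{G}_{KJ}$ and, if $K\le n/B$, $\mathbf{V}_{KI}\leftrightarrow\mathbf{V}_{KJ}$; the products $\mathbf{G}_{KI}^T\mathbf{G}_{KI}$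 and $\mathbf{G}_{KI}^T\mathbf{G}_{KJ}$ are computed by 2.5D matrix multiplication over the $\mu\times\mu\times c$ grid $\mathrm{ProcSlab}(K,I,:)$, and $\mathbf{G}_{KJ}^T\mathbf{G}_{KJ}$ over $\mathrm{ProcSlab}(K,J,:)$ (transposes by swapping fine blocks within the tile). 2. Sum-reductions over $K$ along coarse columns $I$ and $J$ of the top layer yield $\mathbf{G}_I^T\mathbf{G}_I$, $\mathbf{G}_I^T\mathbf{G}_J$ on $\mathrm{ProcTile}(I,I,1)$ and $\mathbf{G}_J^T\mathbf{G}_J$ on $\mathrm{ProcTile}(J,J,1)$; $\mathbf{G}_I^T\mathbf{G}_J$ and its transpose are sent to $\mathrm{ProcTile}(I,J,1)$ and $\mathrm{ProcTile}(J,I,1)$. Thus $\hat{\mathbf{A}}=\mathbf{G}(:,[I,J])^T\mathbf{G}(:,[I,J])\in\mathbb{R}^{2B\times2B}$ is stored on $\mathrm{ProcSlab}([I,J],[I,J],1)$. 3. $\hat{\mathbf{A}}$ is scattered from these $4\mu^2$ processors to a set $\hat{\mathfrak{P}}$ of $2\eta\mu\sqrt{mcP/n}$ processors of $\mathrm{ProcSlab}(:,[I,J],:)$ (an $\eta$ fraction), rearranged as a square 2D grid; each sending processor scatters its $b\times b$ block to $O(\eta\sqrt{mcP/n}/\mu)$ processors. $\hat{\mathbf{V}}$ is initialized to the $2B\times2B$ identity; sweeps of 2D parallel Jacobi are applied to $(\hat{\mathbf{A}},\hat{\mathbf{V}})$ over $\hat{\mathfrak{P}}$ until convergence or a maximum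 number of sweeps; $\hat{\mathbf{V}}$ is gathered back to $\mathrm{ProcSlab}([I,J],[I,J],1)$ (reverse of the scatter) and partitioned into $B\times B$ blocks $\hat{\mathbf{V}}_{ij}$, $i,j\in\{1,2\}$. 4. $\mathrm{ProcTile}(J,I,1)$ sends $\hat{\mathbf{V}}_{21}$ to $\mathrm{ProcTile}(I,I,1)$; $\mathrm{ProcTile}(I,J,1)$ sends $\hat{\mathbf{V}}_{12}$ to $\mathrm{ProcTile}(J,J,1)$. Then $\mathrm{ProcTile}(I,I,1)$ broadcasts $\hat{\mathbf{V}}_{11},\hat{\mathbf{V}}_{21}$ to all other top-layer tiles of coarse column $I$, and $\mathrm{ProcTile}(J,J,1)$ broadcasts $\hat{\mathbf{V}}_{12},\hat{\mathbf{V}}_{22}$ to those of coarse column $J$. 5. For all $K=1,\dots,m/B$ in parallel: $\mathbf{G}_{KI}\leftarrow\mathbf{G}_{KI}\hat{\mathbf{V}}_{11}+\mathbf{G}_{KJ}\hat{\mathbf{V}}_{21}$, $\mathbf{G}_{KJ}\leftarrow\mathbf{G}_{KI}\hat{\mathbf{V}}_{12}+\mathbf{G}_{KJ}\hat{\mathbf{V}}_{22}$, and, if $K\le n/B$, the same update for $\mathbf{V}_{KI},\mathbf{V}_{KJ}$; each $B\times B$ product is computed by 2.5D matrix multiplication over $\mathrm{ProcSlab}(K,I,:)$ or $\mathrm{ProcSlab}(K,J,:)$ respectively. *)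

(* Defs.v *)
From mathcomp Require Import all_boot all_order all_algebra.
From mathcomp Require Import all_classical all_reals all_analysis.

Set Implicit Arguments.
Unset Strict Implicit.
Unset Printing Implicit Defensive.

Import Order.TTheory GRing.Theory Num.Theory.
Local Open Scope ring_scope.

Definition log2 {R : realType} (x : R) : R := ln x / ln 2.

Record cost (R : Type) := Cost { msgs : R; words : R; flops : R }.

(* The costs that are only known up to a constant factor.  mm25 N r c is the
   2.5D product of two N x N matrices on an r x r x c grid (p = r^2 c), gemm k
   and eig k are the flops of a local k x k matrix product and symmetric
   diagonalization. *)
Record cost_model (R : Type) := CostModel {
  p2p_msgs : nat -> R;
  p2p_words : nat -> R;
  mm25 : nat -> nat -> nat -> cost R;
  gemm : nat -> R;
  eig : nat -> R }.

(* kappa bounds all the hidden constants. *)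
Record cost_model_bounded (R : realType) (kappa : R) (M : cost_model R) : Prop := {
  p2p_msgs_le : forall w : nat, p2p_msgs M w <= kappa;
  p2p_words_le : forall w : nat, p2p_words M w <= kappa * w%:R;
  mm25_le : forall N r c : nat, let p : R := (r ^ 2 * c)%:R in
    (1 <= c)%N -> c%:R <= p `^ 3^-1 ->
    [/\ msgs (mm25 M N r c) <= kappa * (Num.sqrt (p / c%:R ^+ 3) + log2 c%:R),
        words (mm25 M N r c) <= kappa * (N%:R ^+ 2 / Num.sqrt (c%:R * p)) &
        flops (mm25 M N r c) <= kappa * (N%:R ^+ 3 / p)];
  gemm_le : forall k : nat, gemm M k <= kappa * k%:R ^+ 3;
  eig_le : forall k : nat, eig M k <= kappa * k%:R ^+ 3 }.

Section Machine.
Variables (R : realType) (T : finType).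

(* An operation occupies all the processors of procs, each of which is charged
   charge. *)
Record op := Op { procs : {set T}; charge : cost R }.

(* The operations of a phase do not depend on each other, but a processor
   executes those it takes part in one after the other.  A processor goes through
   the phases in order; there is no barrier between phases. *)
Definition phase := seq op.
Definition schedule := seq phase.

Definition load (f : cost R -> R) (ph : phase) (x : T) : R :=
  \sum_(o <- ph | x \in procs o) f (charge o).

Definition linked (ph : phase) (x y : T) : bool :=
  (x == y) || has (fun o => (x \in procs o) && (y \in procs o)) ph.

(* Chains x_1, x_2, ... (one processor per phase) in which the work of x_(k+1) in
   phase k+1 has to wait for that of x_k in phase k: both are the same processor
   or they took part in a common operation of phase k.  Phases in which x_k is
   idle cost nothing, so schedules on disjoint sets of processors that are listed
   one after the other run in parallel. *)
Fixpoint longest_chain (f : cost R -> R) (t : schedule) (x : T) : R :=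
  if t is ph :: t' then
    load f ph x + \big[Num.max/0]_(y | linked ph x y) longest_chain f t' y
  else 0.

(* Messages, words and flops are each maximised over all the chains, so that they
   bound the cost of the chain that takes longest whatever the machine. *)
Definition critical_path (f : cost R -> R) (t : schedule) : R :=
  \big[Num.max/0]_(x : T) longest_chain f t x.

Variable M : cost_model R.

Definition send (x y : T) (w : nat) : op :=
  Op [set x; y] (Cost (p2p_msgs M w) (p2p_words M w) 0).

Definition exchange (x y : T) (w : nat) : phase := [:: send x y w; send y x w].

(* Collectives among the processors of A (root included), on w words.  The costs
   are usually stated for #|A| <= w; they are charged for all w here. *)
Definition scatter (A : {set T}) (w : nat) : op :=
  Op A (Cost (log2 #|A|%:R) w%:R 0).
Definition gather (A : {set T}) (w : nat) : op :=
  Op A (Cost (log2 #|A|%:R) w%:R 0).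
Definition broadcast (A : {set T}) (w : nat) : op :=
  Op A (Cost (2 * log2 #|A|%:R) (2 * w%:R) 0).
Definition reduce (A : {set T}) (w : nat) : op :=
  Op A (Cost (2 * log2 #|A|%:R) (2 * w%:R) w%:R).

Definition compute (x : T) (fl : R) : op := Op [set x] (Cost 0 0 fl).

(* N x N product on the r x r x c grid A. *)
Definition matmul25 (A : {set T}) (N r c : nat) : op := Op A (mm25 M N r c).

Definition for_all {I : Type} (s : seq I) (f : I -> phase) : phase :=
  flatten [seq f i | i <- s].

Definition for_pairs (s : seq (nat * nat)) (f : nat -> nat -> phase) : phase :=
  for_all s (fun IJ => f IJ.1 IJ.2).

(* Indices are 1-based. *)
Definition antidiag (q K : nat) : seq (nat * nat) :=
  [seq IJ <- [seq (i, j) | i <- iota 1 q, j <- iota 1 q]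
     | (IJ.1 < IJ.2)%N && (IJ.1 + IJ.2 == K %[mod q])%N].

Section Jacobi2D.
(* at_ I J is the processor in row I, column J of an s x s grid; blocks are
   bh x bh. *)
Variables (at_ : nat -> nat -> T) (s bh : nat).

Let idx := iota 1 s.
Let w := (bh ^ 2)%N.
Let row I : {set T} := [set x in [seq at_ I L | L <- idx]].
Let col I : {set T} := [set x in [seq at_ L I | L <- idx]].
(* A block becomes a sum of two local products. *)
Let update x := compute x (2 * gemm M bh + w%:R).

Definition jacobi2d_group (K : nat) : schedule :=
  let g := antidiag s K in
  [:: for_pairs g (fun I J =>
        [:: send (at_ I I) (at_ I J) w; send (at_ J J) (at_ I J) w]);
      for_pairs g (fun I J => [:: compute (at_ I J) (eig M (2 * bh))]);
      (* two blocks of V and one of D to (I,I) and to (J,J), one of D to (J,I) *)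
      for_pairs g (fun I J =>
        [:: send (at_ I J) (at_ I I) (3 * w); send (at_ I J) (at_ J J) (3 * w);
            send (at_ I J) (at_ J I) w]);
      (* rows of M, columns of M, columns of Q *)
      for_pairs g (fun I J => for_all idx (fun L =>
        exchange (at_ I L) (at_ J L) w ++
        exchange (at_ L I) (at_ L J) w ++ exchange (at_ L I) (at_ L J) w));
      for_pairs g (fun I J =>
        [:: broadcast (row I) (2 * w); broadcast (col I) (2 * w);
            broadcast (row J) (2 * w); broadcast (col J) (2 * w)]);
      for_pairs g (fun I J => for_all idx (fun L =>
        [:: update (at_ I L); update (at_ J L);
            update (at_ L I); update (at_ L J);
            update (at_ L I); update (at_ L J)]))].

Definition jacobi2d_sweep : schedule :=
  flatten [seq jacobi2d_group K | K <- iota 0 s].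

End Jacobi2D.

End Machine.

Section JacobiSVD.
Variables (R : realType) (M : cost_model R).

(* Pr = sqrt(mP/(nc)) and Pc = sqrt(nP/(mc)).  As m = Pr b and n = Pc b, there
   are m/B = Pr/mu coarse rows and n/B = Pc/mu coarse columns. *)
Variables (Pr Pc c mu b : nat).

Definition proc : finType := ('I_Pr * 'I_Pc * 'I_c)%type.

Implicit Types x y : proc.

(* 1-based coarse row, coarse column and layer, 0-based position in the tile. *)
Definition trow x : nat := (x.1.1 %/ mu).+1.
Definition tcol x : nat := (x.1.2 %/ mu).+1.
Definition layer x : nat := x.2.+1.
Definition prow x : nat := (x.1.1 %% mu)%N.
Definition pcol x : nat := (x.1.2 %% mu)%N.

Definition same_pos x y : bool := (prow x == prow y) && (pcol x == pcol y).
Definition transposed_pos x y : bool := (prow x == pcol y) && (pcol x == prow y).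

Definition ProcSlab (rows cols layers : pred nat) : {set proc} :=
  [set x | [&& rows (trow x), cols (tcol x) & layers (layer x)]].
Definition ProcTile (I J k : nat) : {set proc} :=
  ProcSlab (pred1 I) (pred1 J) (pred1 k).

(* Each processor of the top layer holds one fine tile of a matrix. *)
Let w := (b ^ 2)%N.

Definition send_tile (A A' : {set proc}) : phase R proc :=
  for_all (enum [pred xy : proc * proc |
                  [&& xy.1 \in A, xy.2 \in A' & same_pos xy.1 xy.2]])
          (fun xy => [:: send M xy.1 xy.2 w]).

Definition transpose_tile (A : {set proc}) : phase R proc :=
  for_all (enum [pred xy : proc * proc |
                  [&& xy.1 \in A, xy.2 \in A, xy.1 != xy.2
                    & transposed_pos xy.1 xy.2]])
          (fun xy => [:: send M xy.1 xy.2 w]).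

Definition exchange_tiles (A A' : {set proc}) : phase R proc :=
  send_tile A A' ++ send_tile A' A.

(* Collectives along coarse column J of the top layer, one for each position x in
   the root tile (J,J,1). *)
Definition peers (J : nat) x : {set proc} :=
  [set y in ProcSlab predT (pred1 J) (pred1 1%N) | same_pos x y].
Definition reduce_column (J : nat) : phase R proc :=
  [seq reduce R (peers J x) w | x <- enum (ProcTile J J 1)].
Definition broadcast_column (J wds : nat) : phase R proc :=
  [seq broadcast R (peers J x) wds | x <- enum (ProcTile J J 1)].

Definition matmul_slab (K J : nat) : op R proc :=
  matmul25 M (ProcSlab (pred1 K) (pred1 J) predT) (mu * b) mu c.

Definition add_tile (A : {set proc}) : phase R proc :=
  [seq compute x w%:R | x <- enum A].

Section Subproblem.
(* at_ arranges the processors chosen for the subproblem of the pair (I,J) as an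
   s x s grid with bh x bh blocks; nsw is the number of sweeps. *)
Variables (s bh : nat) (I J : nat) (at_ : nat -> nat -> proc) (nsw : nat).

(* Row and column, from 0, of the fine tile on x in the 2 mu x 2 mu fine tiles of
   the Gram matrix of columns I and J. *)
Definition arow x : nat := ((if trow x == I then 0 else mu) + prow x)%N.
Definition acol x : nat := ((if tcol x == I then 0 else mu) + pcol x)%N.

(* Fine rows [i b, (i+1) b) and Jacobi rows [(u-1) bh, u bh) intersect. *)
Definition meets (i u : nat) : bool :=
  (u.-1 * bh < i.+1 * b)%N && (i * b < u * bh)%N.

(* x and the processors whose Jacobi block meets the fine tile on x; bh need not
   divide b. *)
Definition share x : {set proc} :=
  x |: [set y in [seq at_ uv.1 uv.2
                 | uv <- [seq (u, v) | u <- iota 1 s, v <- iota 1 s]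
                   & meets (arow x) uv.1 && meets (acol x) uv.2]].

Definition core : {set proc} := ProcSlab (pred2 I J) (pred2 I J) (pred1 1%N).

Let coarse_rows := iota 1 (Pr %/ mu).
Let n_over_B := (Pc %/ mu)%N.

Definition svd_pair : schedule R proc :=
  [:: for_all coarse_rows (fun K =>
        exchange_tiles (ProcTile K I 1) (ProcTile K J 1) ++
        (if (K <= n_over_B)%N
         then exchange_tiles (ProcTile K I 1) (ProcTile K J 1) else [::]));
      for_all coarse_rows (fun K =>
        transpose_tile (ProcTile K I 1) ++ transpose_tile (ProcTile K J 1));
      for_all coarse_rows (fun K =>
        [:: matmul_slab K I; matmul_slab K I; matmul_slab K J]);
      reduce_column I ++ reduce_column I ++ reduce_column J;
      transpose_tile (ProcTile I I 1);
      send_tile (ProcTile I I 1) (ProcTile I J 1) ++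
      send_tile (ProcTile I I 1) (ProcTile J I 1);
      [seq scatter R (share x) w | x <- enum core]] ++
  flatten (nseq nsw (jacobi2d_sweep M at_ s bh)) ++
  [:: [seq gather R (share x) w | x <- enum core];
      send_tile (ProcTile J I 1) (ProcTile I I 1) ++
      send_tile (ProcTile I J 1) (ProcTile J J 1);
      broadcast_column I (2 * w) ++ broadcast_column J (2 * w);
      (* two products for each of the new G_KI, G_KJ, V_KI, V_KJ *)
      for_all coarse_rows (fun K =>
        let products := [:: matmul_slab K I; matmul_slab K I;
                            matmul_slab K J; matmul_slab K J] in
        products ++ (if (K <= n_over_B)%N then products else [::]));
      for_all coarse_rows (fun K =>
        let sums := add_tile (ProcTile K I 1) ++ add_tile (ProcTile K J 1) in
        sums ++ (if (K <= n_over_B)%N then sums else [::]))].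

End Subproblem.

(* The pairs of a group use disjoint sets of processors. *)
Definition jacobi_svd_sweep (s bh : nat) (place : nat -> nat -> nat -> nat -> proc)
    (sweeps : nat -> nat -> nat) : schedule R proc :=
  flatten [seq flatten [seq svd_pair s bh IJ.1 IJ.2 (place IJ.1 IJ.2)
                                     (sweeps IJ.1 IJ.2)
                       | IJ <- antidiag (Pc %/ mu) g]
          | g <- iota 0 (Pc %/ mu)].

(* For every pair (I,J), place I J arranges s^2 distinct processors of
   ProcSlab(:,[I,J],:) as an s x s grid. *)
Definition placement (s : nat) (place : nat -> nat -> nat -> nat -> proc) : Prop :=
  forall I J, (1 <= I)%N -> (I < J)%N -> (J <= Pc %/ mu)%N ->
    {in [pred uv : nat * nat | (1 <= uv.1 <= s)%N && (1 <= uv.2 <= s)%N] &,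
       injective (fun uv => place I J uv.1 uv.2)} /\
    (forall u v, (1 <= u <= s)%N -> (1 <= v <= s)%N ->
       place I J u v \in ProcSlab predT (pred2 I J) predT).

End JacobiSVD.

(* Main.v *)
(* Write q = Pc / mu for the number of coarse columns.  With n = Pc b, m = Pr b,
   P = Pr Pc c and s^2 = 2 eta mu c Pr, one has X (n/m)^(1/4) = s q / sqrt 2, so
   the three bounds read, up to constants,
     messages  q s log (s^2/2) + (Pr/mu) log (Pr/mu),
     words     q s bh^2 + q mu b^2 / c,
     flops     q s bh^3 + q mu b^3 / c.
   The pairs of a group live on disjoint slabs, so that along a chain a group
   costs no more than its most expensive pair.  In a pair, the phases outside the
   2D Jacobi sweeps are bounded in number and occupy each processor boundedly
   often; so do the phases of each of the s groups of a 2D Jacobi sweep.  It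
   remains to bound a single operation of either kind, which is done at once for
   messages, words and flops by letting f be any of the three. *)
Require Import Defs.
From mathcomp Require Import all_boot all_order all_algebra.
From mathcomp Require Import all_classical all_reals all_analysis.
From mathcomp Require Import zify ring lra.
(* mathcomp-analysis has its own [charge]. *)
Import Defs.

Set Implicit Arguments.
Unset Strict Implicit.
Unset Printing Implicit Defensive.

Import Order.TTheory GRing.Theory Num.Theory.
Local Open Scope ring_scope.

(** * Chains of a schedule *)

(** The counting form of uniqueness: it is how membership in at most one item of a list becomes a
    number that can be multiplied with others. *)
Lemma count_le1 (I : eqType) (s : seq I) (p : pred I) :
  uniq s -> {in s &, forall i j, p i -> p j -> i = j} -> (count p s <= 1)%N.
Proof.
move=> us pinj; rewrite -size_filter.
have := filter_uniq p us; have : {subset seq.filter p s <= s}.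
  by move=> i; rewrite mem_filter => /andP[].
have : all p (seq.filter p s) by exact: filter_all.
case: (seq.filter p s) => [//|i [//|j r]] /= /and3P[pi pj _] sub /andP[+ _].
by rewrite (pinj i j) ?mem_head// ?sub ?inE ?eqxx ?orbT.
Qed.

Section Schedules.
Variables (R : realType) (T : finType).
Implicit Types (ph : phase R T) (t : schedule R T) (f : cost R -> R).
Implicit Types (D : {set T}) (x y : T) (A B : R).

Definition uses ph x : nat := count (fun o => x \in procs o) ph.

Definition peak f ph : R := \big[Num.max/0]_(x : T) load f ph x.

(** A chain can neither enter nor leave [D] while such a schedule runs. The parallelism of the pairs
    of a group rests on this. *)
Definition confined D t : bool := all (all (fun o => procs o \subset D)) t.

Lemma uses_cat ph1 ph2 x : uses (ph1 ++ ph2) x = (uses ph1 x + uses ph2 x)%N.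
Proof. exact: count_cat. Qed.

(** Here [p] marks the items that may involve [x]: at most [n] of them do, and each occupies [x] at
    most [k] times. *)
Lemma uses_for_all (I : eqType) (s : seq I) (F : I -> phase R T) (p : pred I)
    (k n : nat) x :
  {in s, forall i, (0 < uses (F i) x)%N -> p i} ->
  {in s, forall i, (uses (F i) x <= k)%N} -> (count p s <= n)%N ->
  (uses (for_all s F) x <= k * n)%N.
Proof.
move=> Fp Fk sn; apply: leq_trans (leq_mul (leqnn k) sn).
elim: s Fp Fk {sn} => [|i s IH] Fp Fk //; rewrite /for_all /= uses_cat mulnDr.
have sub j : j \in s -> j \in i :: s by rewrite inE => ->; rewrite orbT.
apply: leq_add; last by apply: IH => j js; [exact/Fp/sub|exact/Fk/sub].
have := Fp i (mem_head _ _); have := Fk i (mem_head _ _).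
by case: (uses _ _) => [//|u] uk /(_ isT) ->; rewrite muln1.
Qed.

Lemma uses_for_all_gt0 (I : eqType) (s : seq I) (F : I -> phase R T) x :
  (0 < uses (for_all s F) x)%N -> exists2 i, i \in s & (0 < uses (F i) x)%N.
Proof.
rewrite -has_count /for_all.
elim: s => [//|i s IH] /=; rewrite has_cat => /orP[h|/IH[j js h]].
  by exists i; rewrite ?mem_head// -has_count.
by exists j; rewrite // inE js orbT.
Qed.

Lemma all_for_all (I : eqType) (s : seq I) (F : I -> phase R T) (p : pred (op R T)) :
  {in s, forall i, all p (F i)} -> all p (for_all s F).
Proof.
rewrite /for_all; elim: s => //= i s IH Fp; rewrite all_cat Fp ?mem_head// IH// => j js.
by apply: Fp; rewrite inE js orbT.
Qed.

Lemma peak_ge0 f ph : 0 <= peak f ph.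
Proof. exact: bigmax_ge_id. Qed.

Lemma load_le f a ph x (k : nat) : 0 <= a -> all (fun o => f (charge o) <= a) ph ->
  (uses ph x <= k)%N -> load f ph x <= a *+ k.
Proof.
move=> a0 fa uk; apply: (@le_trans _ _ (a *+ uses ph x)); last exact: ler_wpMn2l.
rewrite /load /uses {uk}; elim: ph fa => [|o ph IH] /=; first by rewrite big_nil.
move=> /andP[oa /IH {}IH]; rewrite big_cons; case: (x \in procs o) => //=.
by rewrite mulrS lerD.
Qed.

Lemma linked_confined D ph x y : all (fun o => procs o \subset D) ph ->
  linked ph x y -> (x \in D) = (y \in D).
Proof.
move=> phD /orP[/eqP->//|]; elim: ph phD => //= o ph IH /andP[/fintype.subsetP oD phD].
by move=> /orP[/andP[/oD-> /oD->]|]//; exact: IH.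
Qed.

(** By [linked_confined] a chain that starts in [D] stays there during [t], so the continuation has
    to be bounded on [D] only, and every phase of [t] adds at most its peak. *)
Lemma longest_chain_cat_in f D t t' B x : confined D t -> 0 <= B ->
  {in D, forall y, longest_chain f t' y <= B} -> x \in D ->
  longest_chain f (t ++ t') x <= \sum_(ph <- t) peak f ph + B.
Proof.
move=> tD B0 t'B; elim: t tD x => [|ph t IH] /=.
  by move=> _ x /t'B; rewrite big_nil add0r.
move=> /andP[phD /IH {}IH] x xD; rewrite big_cons -addrA lerD ?le_bigmax//.
apply: bigmax_le => [|y xy].
  by rewrite addr_ge0// sumr_ge0// => ? _; exact: peak_ge0.
by apply: IH; rewrite -(linked_confined phD xy).
Qed.

(** Outside [D] a processor is idle throughout [t] and linked only to itself, so its chain reaches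
    [t'] without moving or paying. *)
Lemma longest_chain_cat_out f D t t' B x : confined D t -> 0 <= B ->
  longest_chain f t' x <= B -> x \notin D -> longest_chain f (t ++ t') x <= B.
Proof.
move=> tD B0 t'B xD; elim: t tD => [//|ph t IH] /= /andP[phD /IH {}IH].
rewrite (_ : load f ph x = 0) ?add0r; last first.
  rewrite /load; elim: ph phD => [|o ph IHp] /=; first by rewrite big_nil.
  move=> /andP[/fintype.subsetP oD /IHp]; rewrite big_cons => ->.
  by case: ifPn => // /oD; rewrite (negbTE xD).
apply: bigmax_le => // y /orP[/eqP <-//|].
elim: ph phD => //= o ph IHp /andP[/fintype.subsetP oD /IHp {}IHp] /orP[/andP[/oD]|//].
by rewrite (negbTE xD).
Qed.

(** The schedules are listed one after the other, yet a chain can work in at most one of them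
    because the sets [D i] are disjoint. Hence [A] is paid once and not once per [i]. *)
Lemma longest_chain_parallel f (I : eqType) (r : seq I) (F : I -> schedule R T)
    (D : I -> {set T}) t' A B :
  uniq r -> {in r &, forall i j, i != j -> [disjoint D i & D j]} ->
  {in r, forall i, confined (D i) (F i)} ->
  {in r, forall i, \sum_(ph <- F i) peak f ph <= A} -> 0 <= A -> 0 <= B ->
  (forall x, longest_chain f t' x <= B) ->
  forall x, longest_chain f (flatten [seq F i | i <- r] ++ t') x <= A + B.
Proof.
move=> + + + + A0 B0 t'B.
(* The induction needs a sharper form, in which [A] is charged only to processors of some [D i]. *)
suff main : uniq r -> {in r &, forall i j, i != j -> [disjoint D i & D j]} ->
    {in r, forall i, confined (D i) (F i)} ->
    {in r, forall i, \sum_(ph <- F i) peak f ph <= A} ->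
    forall x, longest_chain f (flatten [seq F i | i <- r] ++ t') x <=
      (if has (fun i => x \in D i) r then A else 0) + B.
  move=> ur dis con sum x; apply: le_trans (main ur dis con sum x) _.
  by case: ifP => _; rewrite lerD2r.
elim: r => [|i r IH] /=; first by move=> _ _ _ _ x; rewrite add0r.
move=> /andP[ir ur] dis con sum x.
have sub j : j \in r -> j \in i :: r by rewrite inE => ->; rewrite orbT.
have {}IH := IH ur (sub_in2 sub dis) (sub_in1 sub con) (sub_in1 sub sum).
rewrite -catA; case: ifPn => [|/norP[xi xr]]; last first.
  apply: (longest_chain_cat_out (con i (mem_head _ _))) xi; first by rewrite addr_ge0.
  by have := IH x; rewrite (negbTE xr).
have [xi _|xi /= xr] := boolP (x \in D i); last first.
  apply: (longest_chain_cat_out (con i (mem_head _ _))) xi; first by rewrite addr_ge0.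
  by have := IH x; rewrite xr.
apply: le_trans (_ : \sum_(ph <- F i) peak f ph + B <= _); last first.
  by rewrite lerD2r sum// mem_head.
apply: (longest_chain_cat_in (con i (mem_head _ _)) B0) xi => y yi.
(* Having worked in [D i], the chain is in no other [D j], so the induction hypothesis yields [B]
   alone for the rest. *)
have := IH y; case: hasP => [[j jr yj]|_]; last by rewrite add0r.
have /(dis i j (mem_head _ _) (sub j jr)) : i != j.
  by apply: contraNneq ir => ->.
by move=> /pred0P/(_ y) /=; rewrite yi yj.
Qed.

(** The hypothesis is quantified over every continuation [t'], which lets the bound accumulate from
    the last item of [r] backwards. *)
Lemma critical_path_serial f (I : eqType) (r : seq I) (F : I -> schedule R T) A :
  0 <= A ->
  {in r, forall i t' B, 0 <= B -> (forall x, longest_chain f t' x <= B) ->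
    forall x, longest_chain f (F i ++ t') x <= A + B} ->
  critical_path f (flatten [seq F i | i <- r]) <= A *+ size r.
Proof.
move=> A0 FA; apply: bigmax_le => [|x _]; first exact: mulrn_wge0.
elim: r FA x => [|i r IH] FA x //=; rewrite mulrS.
apply: (FA i (mem_head _ _)); first exact: mulrn_wge0.
by apply: IH => j jr; apply: FA; rewrite inE jr orbT.
Qed.

(** The two properties of a block that [longest_chain_parallel] asks for. Both are stable under
    concatenation, so a block can be assembled phase by phase. *)
Definition tame D f A t : Prop :=
  confined D t /\ \sum_(ph <- t) peak f ph <= A.

Lemma tame_nil D f : tame D f 0 [::].
Proof. by split; rewrite // big_nil. Qed.

Lemma tame_cat D f A B t1 t2 :
  tame D f A t1 -> tame D f B t2 -> tame D f (A + B) (t1 ++ t2).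
Proof.
move=> [c1 s1] [c2 s2]; split; first by rewrite /confined all_cat; apply/andP.
by rewrite big_cat lerD.
Qed.

Lemma tame_cons D f a (k : nat) A ph t : 0 <= a ->
  all (fun o => (procs o \subset D) && (f (charge o) <= a)) ph ->
  (forall x, (uses ph x <= k)%N) ->
  tame D f A t -> tame D f (a *+ k + A) (ph :: t).
Proof.
move=> a0 + uk [ct st]; rewrite all_predI => /andP[phD pha].
split; first by rewrite /= phD.
rewrite big_cons lerD//; apply: bigmax_le => [|x _]; first exact: mulrn_wge0.
exact: load_le.
Qed.

Lemma tame_flatten D f A (I : eqType) (r : seq I) (F : I -> schedule R T) :
  {in r, forall i, tame D f A (F i)} ->
  tame D f (A *+ size r) (flatten [seq F i | i <- r]).
Proof.
elim: r => [|i r IH] Ft; first exact: tame_nil.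
rewrite /= mulrS; apply: tame_cat; first by apply: Ft; rewrite mem_head.
by apply: IH => j jr; apply: Ft; rewrite inE jr orbT.
Qed.

End Schedules.

(** * Disjointness of the pairs of an anti-diagonal group *)

Lemma mem_antidiag q K I J : (I, J) \in antidiag q K ->
  [/\ (1 <= I <= q)%N, (1 <= J <= q)%N, (I < J)%N & I + J = K %[mod q]].
Proof.
rewrite mem_filter => /andP[/andP[IJ /eqP e]].
move=> /allpairsP[[i j] /= [iq jq [eI eJ]]]; subst i j.
by move: iq jq; rewrite !mem_iota !add1n !ltnS.
Qed.

Lemma antidiag_uniq q K : uniq (antidiag q K).
Proof.
apply: filter_uniq; apply: allpairs_uniq; rewrite ?iota_uniq//.
by move=> [? ?] [? ?].
Qed.

(** A shared index fixes the residue of the other one modulo [q], hence the other one itself. If the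
    shared index is the smaller of one pair and the larger of the other, the equality so obtained
    contradicts the two orderings. *)
Lemma antidiag_disjoint q K u : {in antidiag q K &, forall IJ IJ',
  (IJ.1 == u) || (IJ.2 == u) -> (IJ'.1 == u) || (IJ'.2 == u) -> IJ = IJ'}.
Proof.
(* Indices run from 1 to [q], so [q] represents the residue 0 and needs its own cases. *)
have eq_small i j : (1 <= i <= q)%N -> (1 <= j <= q)%N -> i = j %[mod q] -> i = j.
  move=> /andP[i1 iq] /andP[j1 jq].
  have [->|nei] := eqVneq i q; have [->|nej] := eqVneq j q => //.
  - by rewrite modnn modn_small; lia.
  - by rewrite modnn modn_small; lia.
  - by rewrite !modn_small; lia.
move=> [I J] [I' J'] /mem_antidiag[hI hJ ltIJ e] /mem_antidiag[hI' hJ' ltIJ' e'] /=.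
move=> /orP[]/eqP eu /orP[]/eqP eu'; subst u.
- subst I'; congr pair; apply: eq_small => //; apply/eqP.
  by rewrite -(eqn_modDl I) e e'.
- subst J'; have : J = I'; last by lia.
  by apply: eq_small => //; apply/eqP; rewrite -(eqn_modDl I) e addnC e'.
- subst I'; have : I = J'; last by lia.
  by apply: eq_small => //; apply/eqP; rewrite -(eqn_modDl J) addnC e e'.
- subst J'; congr pair; apply: eq_small => //; apply/eqP.
  by rewrite -(eqn_modDr J) e e'.
Qed.

Lemma count_antidiag q K u :
  (count (fun IJ => (IJ.1 == u) || (IJ.2 == u)) (antidiag q K) <= 1)%N.
Proof. exact: count_le1 (antidiag_uniq _ _) (@antidiag_disjoint q K u). Qed.

(** * One group of 2D Jacobi *)

Lemma count_predU_le (I : Type) (p1 p2 : pred I) (s : seq I) (k1 k2 : nat) :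
  (count p1 s <= k1)%N -> (count p2 s <= k2)%N ->
  (count (fun i => p1 i || p2 i) s <= k1 + k2)%N.
Proof.
move=> c1 c2; apply: leq_trans (leq_add c1 c2).
by rewrite -(count_predUI p1 p2) leq_addr.
Qed.

Lemma count_eq_iota (i m n : nat) : (count (fun k => k == i) (iota m n) <= 1)%N.
Proof. by rewrite count_uniq_mem ?iota_uniq// leq_b1. Qed.

Section Jacobi2DCost.
Variables (R : realType) (T : finType) (M : cost_model R).
Variables (at_ : nat -> nat -> T) (s bh : nat) (D : {set T}).
Variables (f : cost R -> R) (a : R).
Hypothesis at_inj : {in [pred uv : nat * nat |
    (1 <= uv.1 <= s)%N && (1 <= uv.2 <= s)%N] &,
  injective (fun uv => at_ uv.1 uv.2)}.
Hypothesis at_in : forall u v, (1 <= u <= s)%N -> (1 <= v <= s)%N -> at_ u v \in D.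

(** Injectivity gives [x] at most one position in the grid, so occupancy of [x] can be counted by
    comparing indices. *)
Lemma grid_position x : exists u v, forall I J,
  x == at_ I J -> (1 <= I <= s)%N -> (1 <= J <= s)%N -> I = u /\ J = v.
Proof.
have [[[u v] /= [hu hv xuv]]|no] := pselect (exists uv : nat * nat,
    [/\ (1 <= uv.1 <= s)%N, (1 <= uv.2 <= s)%N & x = at_ uv.1 uv.2]).
  exists u, v => I J /eqP xIJ hI hJ; have := @at_inj (I, J) (u, v).
  by rewrite !inE hu hv hI hJ /= -xuv -xIJ => /(_ isT isT erefl) [-> ->].
(* A processor outside the grid gets a dummy position, for which the claim is vacuous. *)
exists 0%N, 0%N => I J /eqP xIJ hI hJ; case: no.
by exists (I, J).
Qed.

Hypothesis a_ge0 : 0 <= a.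
Hypothesis send1_le :
  f (Cost (p2p_msgs M (bh ^ 2)) (p2p_words M (bh ^ 2)) 0) <= a.
Hypothesis send3_le :
  f (Cost (p2p_msgs M (3 * bh ^ 2)) (p2p_words M (3 * bh ^ 2)) 0) <= a.
Hypothesis eig_le : f (Cost 0 0 (eig M (2 * bh))) <= a.
Hypothesis update_le : f (Cost 0 0 (2 * gemm M bh + (bh ^ 2)%:R)) <= a.
Hypothesis broadcast_le : forall A : {set T}, (#|A| <= s)%N ->
  f (charge (broadcast R A (2 * bh ^ 2))) <= a.

Lemma subset_grid2 u v u' v' : (1 <= u <= s)%N -> (1 <= v <= s)%N ->
  (1 <= u' <= s)%N -> (1 <= v' <= s)%N -> [set at_ u v; at_ u' v'] \subset D.
Proof.
move=> hu hv hu' hv'; apply/fintype.subsetP => x.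
by rewrite !inE => /orP[]/eqP->; exact: at_in.
Qed.

Lemma subset_grid1 u v : (1 <= u <= s)%N -> (1 <= v <= s)%N ->
  [set at_ u v] \subset D.
Proof. by move=> hu hv; rewrite finset.sub1set at_in. Qed.

Lemma grid_line_le (g : nat -> T) :
  (forall L, (1 <= L <= s)%N -> g L \in D) ->
  ([set x in [seq g L | L <- iota 1 s]] \subset D) &&
  (f (charge (broadcast R [set x in [seq g L | L <- iota 1 s]] (2 * bh ^ 2))) <= a).
Proof.
move=> gD; apply/andP; split.
  apply/fintype.subsetP => x; rewrite inE => /mapP[L + ->].
  by rewrite mem_iota add1n ltnS => /gD.
by apply: broadcast_le; rewrite cardsE (leq_trans (card_size _))// size_map size_iota.
Qed.

(* A pair (I,J) only occupies processors of rows and columns I and J. *)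
Let touches (u v : nat) (IJ : nat * nat) : bool :=
  ((IJ.1 == u) || (IJ.2 == u)) || ((IJ.1 == v) || (IJ.2 == v)).

Let count_touches (K u v : nat) : (count (touches u v) (antidiag s K) <= 2)%N.
Proof. exact (count_predU_le (count_antidiag s K u) (count_antidiag s K v)). Qed.

(** The constant is [6 * 24]: there are six phases, at most two pairs of the group touch the row or
    column of a processor, and a pair occupies it at most 12 times in a phase. *)
Lemma jacobi2d_group_tame K :
  tame D f (a *+ 144) (jacobi2d_group M at_ s bh K).
Proof.
have -> : a *+ 144 = a *+ 24 + (a *+ 24 + (a *+ 24 +
    (a *+ 24 + (a *+ 24 + (a *+ 24 + 0))))) by rewrite addr0 -!mulrnDr.
have sub := @mem_antidiag s K.
do ![apply: tame_cons => //]; last exact: tame_nil.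
- apply: all_for_all => -[I J] /sub[hI hJ _ _] /=.
  by rewrite !subset_grid2 ?send1_le.
- move=> x; have [u [v posx]] := grid_position x.
  apply: leq_trans (@uses_for_all _ _ _ _ _ (touches u v) 12 2 x _ _ (count_touches _ _ _)) _ => //.
  + move=> [I J] /sub[hI hJ _ _]; rewrite -has_count /= !inE orbF /touches.
    by repeat case/orP; move=> /posx[]// eu ev; rewrite ?(eu, ev) ?eqxx ?orbT.
  + by move=> ? _; apply: leq_trans (count_size _ _) _.
- apply: all_for_all => -[I J] /sub[hI hJ _ _] /=.
  by rewrite subset_grid1 ?eig_le.
- move=> x; have [u [v posx]] := grid_position x.
  apply: leq_trans (@uses_for_all _ _ _ _ _ (touches u v) 12 2 x _ _ (count_touches _ _ _)) _ => //.
  + move=> [I J] /sub[hI hJ _ _]; rewrite -has_count /= !inE orbF /touches.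
    by move=> /posx[]// eu ev; rewrite ?(eu, ev) ?eqxx ?orbT.
  + by move=> ? _; apply: leq_trans (count_size _ _) _.
- apply: all_for_all => -[I J] /sub[hI hJ _ _] /=.
  by rewrite !subset_grid2 ?send1_le ?send3_le.
- move=> x; have [u [v posx]] := grid_position x.
  apply: leq_trans (@uses_for_all _ _ _ _ _ (touches u v) 12 2 x _ _ (count_touches _ _ _)) _ => //.
  + move=> [I J] /sub[hI hJ _ _]; rewrite -has_count /= !inE orbF /touches.
    by repeat case/orP; move=> /posx[]// eu ev; rewrite ?(eu, ev) ?eqxx ?orbT.
  + by move=> ? _; apply: leq_trans (count_size _ _) _.
- apply: all_for_all => -[I J] /sub[hI hJ _ _] /=.
  apply: all_for_all => L; rewrite mem_iota add1n ltnS => hL /=.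
  by rewrite !subset_grid2 ?send1_le.
- move=> x; have [u [v posx]] := grid_position x.
  (* For a processor in position [(u, v)] only [L = u] and [L = v] matter, with six operations each:
     this is where 12 comes from. *)
  have touch L I J : (1 <= L <= s)%N -> (1 <= I <= s)%N -> (1 <= J <= s)%N ->
    (0 < uses (exchange M (at_ I L) (at_ J L) (bh ^ 2) ++
       exchange M (at_ L I) (at_ L J) (bh ^ 2) ++
       exchange M (at_ L I) (at_ L J) (bh ^ 2)) x)%N ->
    ((L == u) || (L == v)) && touches u v (I, J).
    move=> hL hI hJ; rewrite -has_count /= !inE orbF /touches.
    by repeat case/orP; move=> /posx[]// eu ev; rewrite ?(eu, ev) ?eqxx ?orbT.
  apply: (@uses_for_all _ _ _ _ _ (touches u v) 12 2 x _ _ (count_touches _ _ _)) => //.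
  + move=> [I J] /sub[hI hJ _ _] /uses_for_all_gt0[L].
    by rewrite mem_iota add1n ltnS => hL /touch => /(_ hL hI hJ) /andP[].
  + move=> [I J] /sub[hI hJ _ _] /=.
    apply: (@uses_for_all _ _ _ _ _ (fun L => (L == u) || (L == v)) 6 2 x) => //.
    * move=> L; rewrite mem_iota add1n ltnS => hL.
      by move=> /touch => /(_ hL hI hJ) /andP[].
    * by move=> ? _; apply: leq_trans (count_size _ _) _.
    * exact (count_predU_le (count_eq_iota u 1 s) (count_eq_iota v 1 s)).
- apply: all_for_all => -[I J] /sub[hI hJ _ _] /=.
  by rewrite !grid_line_le// => L hL; exact: at_in.
- move=> x; have [u [v posx]] := grid_position x.
  apply: leq_trans (@uses_for_all _ _ _ _ _ (touches u v) 12 2 x _ _ (count_touches _ _ _)) _ => //.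
  + move=> [I J] /sub[hI hJ _ _]; rewrite -has_count /= !inE orbF /touches.
    by repeat case/orP; move=> /mapP[L]; rewrite mem_iota add1n ltnS => hL /eqP/posx[]// eu ev;
      rewrite ?(eu, ev) ?eqxx ?orbT.
  + by move=> ? _; apply: leq_trans (count_size _ _) _.
- apply: all_for_all => -[I J] /sub[hI hJ _ _] /=.
  apply: all_for_all => L; rewrite mem_iota add1n ltnS => hL /=.
  by rewrite !subset_grid1 ?update_le.
- move=> x; have [u [v posx]] := grid_position x.
  apply: (@uses_for_all _ _ _ _ _ (touches u v) 12 2 x _ _ (count_touches _ _ _)) => //.
  + move=> [I J] /sub[hI hJ _ _] /uses_for_all_gt0[L].
    rewrite mem_iota add1n ltnS -has_count /= !inE orbF /touches => hL.
    by repeat case/orP; move=> /posx[]// eu ev; rewrite ?(eu, ev) ?eqxx ?orbT.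
  + move=> [I J] /sub[hI hJ _ _] /=.
    apply: (@uses_for_all _ _ _ _ _ (fun L => (L == u) || (L == v)) 6 2 x) => //.
    * move=> L; rewrite mem_iota add1n ltnS -has_count /= !inE orbF => hL.
      by repeat case/orP; move=> /posx[]// eu ev; rewrite ?(eu, ev) ?eqxx ?orbT.
    * by move=> ? _; apply: leq_trans (count_size _ _) _.
    * exact (count_predU_le (count_eq_iota u 1 s) (count_eq_iota v 1 s)).
Qed.

Lemma jacobi2d_sweep_tame :
  tame D f (a *+ 144 *+ s) (jacobi2d_sweep M at_ s bh).
Proof.
have := tame_flatten (r := iota 0 s) (fun K _ => jacobi2d_group_tame K).
by rewrite size_iota.
Qed.

End Jacobi2DCost.

(** * Occupancy of the processor grid *)

Section Layout.
Variables (Pr Pc c mu : nat).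
Notation proc := (proc Pr Pc c).
Notation Tile K J := (ProcTile Pr Pc c mu K J 1).
Implicit Types x y : proc.

Lemma proc_ext x y : trow mu x = trow mu y -> tcol mu x = tcol mu y ->
  layer x = layer y -> prow mu x = prow mu y -> pcol mu x = pcol mu y -> x = y.
Proof.
case: x => [[xr xc] xl]; case: y => [[yr yc] yl] /=.
rewrite /trow /tcol /layer /prow /pcol /= => -[er] -[ec] [el] er' ec'.
congr (_, _, _); apply: val_inj => //=.
  by rewrite (divn_eq xr mu) (divn_eq yr mu) er er'.
by rewrite (divn_eq xc mu) (divn_eq yc mu) ec ec'.
Qed.

Lemma mem_ProcTile K J x :
  x \in Tile K J = [&& trow mu x == K, tcol mu x == J & layer x == 1%N].
Proof. by rewrite inE. Qed.

(** This makes communication between two tiles a matching: a processor has at most one partner in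
    the other tile. *)
Lemma ProcTile_same_pos K J : {in Tile K J &, forall x y, same_pos mu x y -> x = y}.
Proof.
move=> x y; rewrite !mem_ProcTile.
move=> /and3P[/eqP xK /eqP xJ /eqP xl] /and3P[/eqP yK /eqP yJ /eqP yl].
by move=> /andP[/eqP er /eqP ec]; apply: proc_ext; rewrite ?xK ?xJ ?xl.
Qed.

Lemma same_pos_sym x y : same_pos mu x y = same_pos mu y x.
Proof. by rewrite /same_pos eq_sym [pcol _ _ == _]eq_sym. Qed.

Lemma same_pos_trans x y z : same_pos mu x y -> same_pos mu y z -> same_pos mu x z.
Proof.
move=> /andP[/eqP e1 /eqP e2] /andP[/eqP e3 /eqP e4].
by rewrite /same_pos e1 e2 e3 e4 !eqxx.
Qed.

(** Peers share coarse column, layer and position, so their coarse row tells them apart. *)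
Lemma card_peers J x : (0 < mu)%N -> (mu %| Pr)%N ->
  (#|peers mu J x| <= Pr %/ mu)%N.
Proof.
move=> mu0 dvd; rewrite cardE -(size_iota 0 (Pr %/ mu)).
rewrite -(size_map (fun y : proc => y.1.1 %/ mu)%N).
apply: uniq_leq_size; last first.
  move=> _ /mapP[y _ ->]; rewrite mem_iota /= add0n ltn_divLR// divnK//.
rewrite map_inj_in_uniq ?enum_uniq// => y z.
rewrite !mem_enum !inE /=.
move=> /and3P[/andP[/eqP yJ /eqP yl] /eqP p1 /eqP p2].
move=> /and3P[/andP[/eqP zJ /eqP zl] /eqP p3 /eqP p4] yz.
by apply: proc_ext; rewrite -?p1 -?p2 ?yJ ?yl// /trow yz.
Qed.

Variables (R : realType) (M : cost_model R) (b : nat).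

(** The two hypotheses make [P] a partial matching: [x] sends at most once and receives at most
    once. *)
Lemma uses_sends (P : pred (proc * proc)) x w :
  {in P &, forall p q, p.1 = q.1 -> p = q} ->
  {in P &, forall p q, p.2 = q.2 -> p = q} ->
  (uses (for_all (enum P) (fun xy => [:: send M xy.1 xy.2 w])) x <= 2)%N.
Proof.
move=> inj1 inj2.
apply: (@uses_for_all _ _ _ _ _ (fun xy => (xy.1 == x) || (xy.2 == x)) 1 2).
- by move=> yz _; rewrite -has_count /= !inE orbF ![x == _]eq_sym.
- by move=> ? _; exact: count_size.
- apply: (count_predU_le (k1 := 1) (k2 := 1)); apply: count_le1 (enum_uniq _) _.
    by move=> p q; rewrite !mem_enum => Pp Pq /eqP pE /eqP qE; apply: inj1; rewrite ?qE.
  by move=> p q; rewrite !mem_enum => Pp Pq /eqP pE /eqP qE; apply: inj2; rewrite ?qE.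
Qed.

Lemma uses_sends_gt0 (P : pred (proc * proc)) x w :
  (0 < uses (for_all (enum P) (fun xy => [:: send M xy.1 xy.2 w])) x)%N ->
  exists2 yz, P yz & x = yz.1 \/ x = yz.2.
Proof.
move=> /uses_for_all_gt0[yz]; rewrite mem_enum -has_count /= !inE orbF => Pyz h.
by exists yz => //; case/orP: h => /eqP; [left|right].
Qed.

Lemma uses_send_tile K J K' J' x : (uses (send_tile M mu b (Tile K J) (Tile K' J')) x <= 2)%N.
Proof.
apply: uses_sends => -[y z] [y' z'] /and3P[/= yT zT yz] /and3P[/= yT' zT' yz'] e.
  congr pair => //; apply: (ProcTile_same_pos zT zT').
  by rewrite same_pos_sym in yz; apply: same_pos_trans yz _; rewrite e.
congr pair => //; apply: (ProcTile_same_pos yT yT').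
by apply: same_pos_trans yz _; rewrite e same_pos_sym.
Qed.

Lemma uses_send_tile_gt0 (A A' : {set proc}) x :
  (0 < uses (send_tile M mu b A A') x)%N -> x \in A :|: A'.
Proof.
by move=> /uses_sends_gt0[[y z] /and3P[/= yA zA _] [->|->]]; rewrite inE ?yA ?zA ?orbT.
Qed.

Lemma uses_transpose_tile K J x : (uses (transpose_tile M mu b (Tile K J)) x <= 2)%N.
Proof.
apply: uses_sends => -[y z] [y' z'] /and4P[/= yT zT _ /andP[/eqP p1 /eqP p2]];
  move=> /and4P[/= yT' zT' _ /andP[/eqP p3 /eqP p4]] e; congr pair => //.
  by apply: (ProcTile_same_pos zT zT'); rewrite /same_pos -p1 -p2 -p3 -p4 e !eqxx.
by apply: (ProcTile_same_pos yT yT'); rewrite /same_pos p1 p2 p3 p4 e !eqxx.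
Qed.

Lemma uses_transpose_tile_gt0 (A : {set proc}) x :
  (0 < uses (transpose_tile M mu b A) x)%N -> x \in A.
Proof. by move=> /uses_sends_gt0[[y z] /and3P[/= yA zA _] [->|->]]. Qed.

(** Collectives with distinct roots are disjoint, since [x] is a peer only of the root at its own
    position. *)
Lemma uses_column (F : {set proc} -> op R proc) J x :
  (forall A, procs (F A) = A) ->
  (uses [seq F (peers mu J y) | y <- enum (Tile J J)] x <= 1)%N.
Proof.
move=> FA; rewrite /uses count_map; apply: count_le1 (enum_uniq _) _ => y z.
rewrite !mem_enum => yT zT /=; rewrite !FA !inE => /andP[_ yx] /andP[_ zx].
by apply: (ProcTile_same_pos yT zT); apply: same_pos_trans yx _; rewrite same_pos_sym.
Qed.

Lemma uses_add_tile A x : (uses (add_tile R b A) x <= (x \in A))%N.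
Proof.
rewrite /uses count_map; have [xA|xA] := boolP (x \in A).
  apply: count_le1 (enum_uniq _) _ => y z _ _ /=.
  by rewrite !inE => /eqP <- /eqP <-.
rewrite leqn0 eqn0Ngt -has_count; apply/hasPn => y; rewrite mem_enum /= inE => yA.
by apply: contraNneq xA => ->.
Qed.

(** * Overlap of fine tiles with Jacobi blocks *)

Section Sharing.
Variables (s bh I J : nat) (at_ : nat -> nat -> proc).
Hypotheses (mu_gt0 : (0 < mu)%N) (IJ : I != J) (bh_le : (bh <= b)%N).
Hypothesis at_inj : {in [pred uv : nat * nat |
    (1 <= uv.1 <= s)%N && (1 <= uv.2 <= s)%N] &,
  injective (fun uv => at_ uv.1 uv.2)}.

Lemma card_share x : (#|share mu b s bh I at_ x| <= (s ^ 2).+1)%N.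
Proof.
rewrite cardsU1; apply: (@leq_add _ _ 1 (s ^ 2)); first exact: leq_b1.
rewrite cardsE (leq_trans (card_size _))//.
rewrite size_map size_filter (leq_trans (count_size _ _))//.
by rewrite size_allpairs !size_iota mulnn.
Qed.

(* A Jacobi block is no larger than a fine tile, so it meets at most two rows of
   fine tiles. *)
Lemma meets_two i u : (0 < u)%N -> (0 < b)%N -> meets b bh i u ->
  (i == (u.-1 * bh) %/ b)%N || (i == ((u.-1 * bh) %/ b).+1)%N.
Proof.
case: u => // u _ b0; rewrite /meets /= => /andP[h1 h2].
have := divn_eq (u * bh) b; have := ltn_pmod (u * bh) b0.
move: (_ %/ _)%N (_ %% _)%N => q r; rewrite mulSn in h2 => rb e.
have h3 : (q * b < i.+1 * b)%N by lia.
have h4 : (i * b < q.+2 * b)%N by rewrite !mulSn; lia.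
by move: h3 h4; rewrite !ltn_pmul2r//; lia.
Qed.

(** Fine rows of tile row [I] are numbered below [mu], those of tile row [J] from [mu] on, so the
    number gives back both the tile and the position in it; likewise for columns. *)
Lemma core_position_inj : {in core Pr Pc c mu I J &, forall x y,
  arow mu I x = arow mu I y -> acol mu I x = acol mu I y -> x = y}.
Proof.
have tile_eq t t' p p' : (t == I) || (t == J) -> (t' == I) || (t' == J) ->
    (p < mu)%N -> (p' < mu)%N ->
    ((if t == I then 0 else mu) + p = (if t' == I then 0 else mu) + p')%N ->
    t = t' /\ p = p'.
  by case: (eqVneq t I) => [->|_]; case: (eqVneq t' I) => [->|_] /=; lia.
move=> x y; rewrite !inE => /and3P[xr xc /eqP xl] /and3P[yr yc /eqP yl] er ec.
have [er1 er2] := tile_eq _ _ _ _ xr yr (ltn_pmod _ mu_gt0) (ltn_pmod _ mu_gt0) er.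
have [ec1 ec2] := tile_eq _ _ _ _ xc yc (ltn_pmod _ mu_gt0) (ltn_pmod _ mu_gt0) ec.
by apply: proc_ext => //; rewrite xl yl.
Qed.

(** The five are [y] itself and the four fine tiles, in two rows and two columns, that the Jacobi
    block on [y] can meet. So [y] takes part in boundedly many of the concurrent scatters. *)
Lemma count_share y : (0 < b)%N ->
  (count (fun x => y \in share mu b s bh I at_ x) (enum (core Pr Pc c mu I J)) <= 5)%N.
Proof.
move=> b0; have [u [v posy]] := grid_position at_inj y.
(* The 0-based fine row and column of the first entry of the Jacobi block [(u, v)]. *)
pose i := ((u.-1 * bh) %/ b)%N; pose j := ((v.-1 * bh) %/ b)%N.
pose at_pos k l x := (arow mu I x == k) && (acol mu I x == l).
have at_pos1 k l : (count (at_pos k l) (enum (core Pr Pc c mu I J)) <= 1)%N.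
  apply: count_le1 (enum_uniq _) _ => x x'; rewrite !mem_enum => xc xc'.
  move=> /andP[/eqP e1 /eqP e2] /andP[/eqP e3 /eqP e4].
  by apply: (core_position_inj xc xc'); rewrite ?e1 ?e2.
have self : (count (fun x => x == y) (enum (core Pr Pc c mu I J)) <= 1)%N.
  by rewrite count_uniq_mem ?enum_uniq// leq_b1.
have := count_predU_le self (count_predU_le (count_predU_le (at_pos1 i j) (at_pos1 i j.+1))
  (count_predU_le (at_pos1 i.+1 j) (at_pos1 i.+1 j.+1))).
apply: leq_trans; apply: sub_count => x /=; rewrite !inE => /orP[/eqP->|].
  by rewrite eqxx.
move=> /mapP[[u' v']]; rewrite mem_filter => /andP[/= /andP[m1 m2]].
move=> /allpairsP[[u'' v''] /= [hu hv [eu ev]]]; subst u'' v''.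
move: hu hv; rewrite !mem_iota !add1n !ltnS => hu hv.
move=> /eqP/posy /(_ hu hv)[eu ev]; subst u' v'.
have /andP[u0 _] := hu; have /andP[v0 _] := hv.
have := meets_two u0 b0 m1; have := meets_two v0 b0 m2; rewrite -/i -/j /at_pos.
by move=> /orP[]/eqP-> /orP[]/eqP->; rewrite !eqxx ?orbT.
Qed.

End Sharing.
End Layout.

(** * One pair and one sweep of the SVD *)

Section PairCost.
Variables (R : realType) (M : cost_model R) (Pr Pc c mu b s bh : nat).
Variables (f : cost R -> R) (a d : R).
Notation proc := (proc Pr Pc c).
Notation Tile K J := (ProcTile Pr Pc c mu K J 1).

Hypotheses (mu_gt0 : (0 < mu)%N) (b_gt0 : (0 < b)%N) (bh_le : (bh <= b)%N).
Hypotheses (mu_dvd_Pr : (mu %| Pr)%N).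

Hypothesis a_ge0 : 0 <= a.
Hypothesis block_send_le :
  f (Cost (p2p_msgs M (bh ^ 2)) (p2p_words M (bh ^ 2)) 0) <= a.
Hypothesis block_send3_le :
  f (Cost (p2p_msgs M (3 * bh ^ 2)) (p2p_words M (3 * bh ^ 2)) 0) <= a.
Hypothesis block_eig_le : f (Cost 0 0 (eig M (2 * bh))) <= a.
Hypothesis block_update_le : f (Cost 0 0 (2 * gemm M bh + (bh ^ 2)%:R)) <= a.
Hypothesis block_broadcast_le : forall A : {set proc}, (#|A| <= s)%N ->
  f (charge (broadcast R A (2 * bh ^ 2))) <= a.

Hypothesis d_ge0 : 0 <= d.
Hypothesis send_le : f (Cost (p2p_msgs M (b ^ 2)) (p2p_words M (b ^ 2)) 0) <= d.
Hypothesis matmul_le : f (mm25 M (mu * b) mu c) <= d.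
Hypothesis sum_le : f (Cost 0 0 (b ^ 2)%:R) <= d.
Hypothesis reduce_le : forall A : {set proc}, (#|A| <= Pr %/ mu)%N ->
  f (charge (reduce R A (b ^ 2))) <= d.
Hypothesis broadcast_le : forall A : {set proc}, (#|A| <= Pr %/ mu)%N ->
  f (charge (broadcast R A (2 * b ^ 2))) <= d.
Hypothesis scatter_le : forall A : {set proc}, (#|A| <= (s ^ 2).+1)%N ->
  f (charge (scatter R A (b ^ 2))) <= d.

Section Pair.
Variables (I J : nat) (at_ : nat -> nat -> proc) (nsw : nat).
Hypothesis IJ : I != J.
Hypothesis at_inj : {in [pred uv : nat * nat |
    (1 <= uv.1 <= s)%N && (1 <= uv.2 <= s)%N] &,
  injective (fun uv => at_ uv.1 uv.2)}.

Let D : {set proc} := ProcSlab Pr Pc c mu predT (pred2 I J) predT.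
Hypothesis at_in : forall u v, (1 <= u <= s)%N -> (1 <= v <= s)%N -> at_ u v \in D.

Let ok (o : op R proc) := (procs o \subset D) && (f (charge o) <= d).

Let slab_sub (p q r : pred nat) : {subset q <= pred2 I J} ->
  ProcSlab Pr Pc c mu p q r \subset D.
Proof.
move=> qIJ; apply/fintype.subsetP => x; rewrite inE => /and3P[_ /qIJ xIJ _].
by rewrite inE; apply/and3P.
Qed.

Let subI : {subset pred1 I <= pred2 I J}.
Proof. by move=> k; rewrite !inE => ->. Qed.

Let subJ : {subset pred1 J <= pred2 I J}.
Proof. by move=> k; rewrite !inE => ->; rewrite orbT. Qed.

Let ok_send x y : x \in D -> y \in D -> ok (send M x y (b ^ 2)).
Proof.
move=> xD yD; rewrite /ok send_le andbT.
by apply/fintype.subsetP => z /finset.set2P[]->.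
Qed.

Let ok_send_tile (A A' : {set proc}) : A \subset D -> A' \subset D ->
  all ok (send_tile M mu b A A').
Proof.
move=> /fintype.subsetP AD /fintype.subsetP A'D; apply: all_for_all => -[x y].
by rewrite mem_enum => /and3P[/= /AD xD /A'D yD _]; rewrite ok_send.
Qed.

Let ok_transpose_tile (A : {set proc}) : A \subset D ->
  all ok (transpose_tile M mu b A).
Proof.
move=> /fintype.subsetP AD; apply: all_for_all => -[x y].
by rewrite mem_enum => /and4P[/= /AD xD /AD yD _ _]; rewrite ok_send.
Qed.

Let ok_exchange K : all ok (exchange_tiles M mu b (Tile K I) (Tile K J)).
Proof. by rewrite all_cat !ok_send_tile//; apply: slab_sub. Qed.

Let peers_sub J' x : {subset pred1 J' <= pred2 I J} -> peers mu J' x \subset D.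
Proof.
move=> J'IJ; apply: fintype.subset_trans (slab_sub predT (pred1 1%N) J'IJ).
by apply/fintype.subsetP => y; rewrite !inE => /andP[].
Qed.

Let ok_reduce J' : {subset pred1 J' <= pred2 I J} ->
  all ok (reduce_column R Pr Pc c mu b J').
Proof.
move=> J'IJ; rewrite all_map; apply/allP => x _ /=.
by rewrite /ok peers_sub// reduce_le// card_peers.
Qed.

Let ok_broadcast J' : {subset pred1 J' <= pred2 I J} ->
  all ok (broadcast_column R Pr Pc c mu J' (2 * b ^ 2)).
Proof.
move=> J'IJ; rewrite all_map; apply/allP => x _ /=.
by rewrite /ok peers_sub// broadcast_le// card_peers.
Qed.

Let ok_matmul K J' : {subset pred1 J' <= pred2 I J} ->
  ok (matmul_slab M Pr Pc c mu b K J').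
Proof. by move=> J'IJ; rewrite /ok slab_sub. Qed.

Let ok_add_tile (A : {set proc}) : A \subset D -> all ok (add_tile R b A).
Proof.
move=> /fintype.subsetP AD; rewrite all_map; apply/allP => x.
by rewrite mem_enum => /AD xD; rewrite /= /ok finset.sub1set xD.
Qed.

Let share_sub x : x \in core Pr Pc c mu I J -> share mu b s bh I at_ x \subset D.
Proof.
move=> xc; apply/fintype.subsetP => y; rewrite !inE => /orP[/eqP->|].
  by move: xc; rewrite !inE => /and3P[_ ->].
move=> /mapP[[u v]]; rewrite mem_filter => /andP[_] /allpairsP[[u' v'] /=].
rewrite !mem_iota !add1n !ltnS => -[hu hv [-> ->]] ->.
by have := at_in hu hv; rewrite inE.
Qed.

Let ok_scatter :
  all ok [seq scatter R (share mu b s bh I at_ x) (b ^ 2)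
         | x <- enum (core Pr Pc c mu I J)].
Proof.
rewrite all_map; apply/allP => x; rewrite mem_enum => /share_sub xD /=.
by rewrite /ok xD scatter_le// card_share.
Qed.

(** A processor lies in one coarse row, so it takes part in a single iteration of the loop over
    [K]. *)
Let uses_rows (F : nat -> phase R proc) (N k : nat) x :
  (forall K, (0 < uses (F K) x)%N -> trow mu x == K) ->
  (forall K, uses (F K) x <= k)%N -> (k <= 8)%N ->
  (uses (for_all (iota 1 N) F) x <= 8)%N.
Proof.
move=> Frow Fk; apply: leq_trans; rewrite -[leqRHS]muln1.
apply: (@uses_for_all _ _ _ _ _ (fun K => K == trow mu x)) (count_eq_iota _ _ _).
  by move=> K _ /Frow; rewrite eq_sym.
by move=> K _; exact: Fk.
Qed.

Let trow_tile K J' x : x \in Tile K J' -> trow mu x == K.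
Proof. by rewrite mem_ProcTile => /and3P[]. Qed.

Let trow_send K J1 J2 x :
  (0 < uses (send_tile M mu b (Tile K J1) (Tile K J2)) x)%N -> trow mu x == K.
Proof. by move=> /uses_send_tile_gt0; rewrite inE => /orP[]/trow_tile. Qed.

Let trow_exchange K J1 J2 x :
  (0 < uses (exchange_tiles M mu b (Tile K J1) (Tile K J2)) x)%N -> trow mu x == K.
Proof. by rewrite uses_cat addn_gt0 => /orP[]/trow_send. Qed.

Let uses_exchange K J1 J2 x :
  (uses (exchange_tiles M mu b (Tile K J1) (Tile K J2)) x <= 4)%N.
Proof. by rewrite uses_cat; apply: (@leq_add _ _ 2 2); exact: uses_send_tile. Qed.

Let trow_matmul K J' x : x \in procs (matmul_slab M Pr Pc c mu b K J') ->
  trow mu x == K.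
Proof. by rewrite inE => /and3P[]. Qed.

Let trow_add_tile K J' x : (0 < uses (add_tile R b (Tile K J')) x)%N ->
  trow mu x == K.
Proof.
by move=> /leq_trans/(_ (uses_add_tile _ _ _ _)); rewrite lt0b; exact: trow_tile.
Qed.

Lemma jacobi2d_sweeps_tame :
  tame D f (a *+ 144 *+ s *+ nsw) (flatten (nseq nsw (jacobi2d_sweep M at_ s bh))).
Proof.
elim: nsw => [|k IH]; first exact: tame_nil.
by rewrite mulrS; apply: tame_cat IH; exact: jacobi2d_sweep_tame.
Qed.

(** Here [a] bounds one operation inside the Jacobi sweeps and [d] one outside. The constant is
    [96 = 12 * 8]: seven phases before the sweeps and five after, each occupying a processor at most
    8 times. The 8 accounts for the phases that treat both [G] and [V], with at most four sends or
    products each. *)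
Lemma svd_pair_tame :
  tame D f (d *+ 96 + a *+ 144 *+ s *+ nsw) (svd_pair M mu b s bh I J at_ nsw).
Proof.
have -> : d *+ 96 + a *+ 144 *+ s *+ nsw =
    (d *+ 8 + (d *+ 8 + (d *+ 8 + (d *+ 8 + (d *+ 8 + (d *+ 8 + (d *+ 8 + 0))))))) +
    (a *+ 144 *+ s *+ nsw +
    (d *+ 8 + (d *+ 8 + (d *+ 8 + (d *+ 8 + (d *+ 8 + 0)))))) by ring.
apply: tame_cat; last apply: tame_cat jacobi2d_sweeps_tame _.
- do ![apply: tame_cons => //]; last exact: tame_nil.
  + apply: all_for_all => K _; rewrite all_cat ok_exchange /=.
    by case: ifP => // _; exact: ok_exchange.
  + move=> x; apply: (@uses_rows _ _ 8) => // K; rewrite uses_cat.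
      by case: ifP => _; rewrite addn_gt0 => /orP[]// /trow_exchange.
    apply: (@leq_add _ _ 4 4); first exact: uses_exchange.
    by case: ifP => // _; exact: uses_exchange.
  + apply: all_for_all => K _.
    by rewrite all_cat !ok_transpose_tile// slab_sub.
  + move=> x; apply: (@uses_rows _ _ 4) => // K; rewrite uses_cat.
      by rewrite addn_gt0 => /orP[]/uses_transpose_tile_gt0/trow_tile.
    by apply: (@leq_add _ _ 2 2); exact: uses_transpose_tile.
  + by apply: all_for_all => K _; apply/and4P; split=> //; exact: ok_matmul.
  + move=> x; apply: (@uses_rows _ _ 3) => // K; last exact: count_size.
    by rewrite -has_count /= orbF => /or3P[]/trow_matmul.
  + by rewrite !all_cat !ok_reduce.
  + move=> x; rewrite !uses_cat.
    have one J' : (uses (reduce_column R Pr Pc c mu b J') x <= 1)%N.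
      exact: (@uses_column _ _ _ _ _ (fun A => reduce R A (b ^ 2))).
    by apply: leq_trans (leq_add (one I) (leq_add (one I) (one J))) _.
  + by rewrite ok_transpose_tile// slab_sub.
  + by move=> x; apply: (@leq_trans 2) => //; exact: uses_transpose_tile.
  + by rewrite all_cat !ok_send_tile// slab_sub.
  + move=> x; rewrite uses_cat.
    by apply: (@leq_trans (2 + 2)) => //; apply: leq_add; exact: uses_send_tile.
  + move=> x; rewrite /uses count_map.
    by apply: leq_trans (count_share (I := I) (J := J) mu_gt0 IJ bh_le at_inj x b_gt0) _.
- do ![apply: tame_cons => //]; last exact: tame_nil.
  + move=> x; rewrite /uses count_map.
    by apply: leq_trans (count_share (I := I) (J := J) mu_gt0 IJ bh_le at_inj x b_gt0) _.
  + by rewrite all_cat !ok_send_tile// slab_sub.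
  + move=> x; rewrite uses_cat.
    by apply: (@leq_trans (2 + 2)) => //; apply: leq_add; exact: uses_send_tile.
  + by rewrite all_cat !ok_broadcast.
  + move=> x; rewrite uses_cat.
    have one J' : (uses (broadcast_column R Pr Pc c mu J' (2 * b ^ 2)) x <= 1)%N.
      exact: (@uses_column _ _ _ _ _ (fun A => broadcast R A (2 * b ^ 2))).
    by apply: leq_trans (leq_add (one I) (one J)) _.
  + have products K : all ok [:: matmul_slab M Pr Pc c mu b K I;
        matmul_slab M Pr Pc c mu b K I; matmul_slab M Pr Pc c mu b K J;
        matmul_slab M Pr Pc c mu b K J].
      by apply/and5P; split=> //; exact: ok_matmul.
    apply: all_for_all => K _; rewrite all_cat; apply/andP; split=> //.
    by case: ifP => // _; exact: products.
  + move=> x; have products K : (0 < uses [:: matmul_slab M Pr Pc c mu b K I;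
        matmul_slab M Pr Pc c mu b K I; matmul_slab M Pr Pc c mu b K J;
        matmul_slab M Pr Pc c mu b K J] x)%N -> trow mu x == K.
      by rewrite -has_count /= orbF; repeat case/orP; exact: trow_matmul.
    apply: (@uses_rows _ _ 8) => // K.
      rewrite uses_cat addn_gt0 => /orP[|]; last case: ifP => // _; exact: products.
    rewrite uses_cat; apply: (@leq_add _ _ 4 4); first exact: count_size.
    by case: ifP => // _; exact: count_size.
  + apply: all_for_all => K _; rewrite !all_cat !ok_add_tile ?slab_sub//=.
    by case: ifP => // _; rewrite !all_cat !ok_add_tile ?slab_sub.
  + move=> x; apply: (@uses_rows _ _ 4) => // K.
      rewrite !uses_cat !addn_gt0 -orbA => /or3P[/trow_add_tile//|/trow_add_tile//|].
      by case: ifP => // _; rewrite uses_cat addn_gt0 => /orP[]/trow_add_tile.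
    have two : (uses (add_tile R b (Tile K I) ++ add_tile R b (Tile K J)) x <= 2)%N.
      rewrite uses_cat; apply: (@leq_add _ _ 1 1);
        exact: leq_trans (uses_add_tile _ _ _ _) (leq_b1 _).
    by rewrite uses_cat; apply: (@leq_add _ _ 2 2) => //; case: ifP.
Qed.

End Pair.

Lemma jacobi_svd_sweep_critical_path (place : nat -> nat -> nat -> nat -> proc)
    (sweeps : nat -> nat -> nat) (max_sweeps : nat) :
  placement mu s place -> (forall I J, (sweeps I J <= max_sweeps)%N) ->
  critical_path f (jacobi_svd_sweep M mu b s bh place sweeps) <=
    (d *+ 96 + a *+ 144 *+ s *+ max_sweeps) *+ (Pc %/ mu).
Proof.
move=> placed sweeps_le.
have A0 : 0 <= d *+ 96 + a *+ 144 *+ s *+ max_sweeps by rewrite addr_ge0 ?mulrn_wge0.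
rewrite -[X in _ *+ X](size_iota 0); apply: (critical_path_serial A0).
move=> g _ t' B B0 t'B.
have pairP IJ : IJ \in antidiag (Pc %/ mu) g ->
    tame (ProcSlab Pr Pc c mu predT (pred2 IJ.1 IJ.2) predT) f
      (d *+ 96 + a *+ 144 *+ s *+ max_sweeps)
      (svd_pair M mu b s bh IJ.1 IJ.2 (place IJ.1 IJ.2) (sweeps IJ.1 IJ.2)).
  case: IJ => I J /mem_antidiag[/andP[I1 _] /andP[_ Jq] ltIJ _].
  have [inj ins] := placed I J I1 ltIJ Jq.
  have neIJ : I != J by rewrite neq_ltn ltIJ.
  have [con sum] := svd_pair_tame (sweeps I J) neIJ inj ins.
  split=> //; apply: le_trans sum _; rewrite lerD2l.
  by apply: ler_wpMn2l (sweeps_le _ _); rewrite !mulrn_wge0.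
apply: (longest_chain_parallel
  (D := fun IJ => ProcSlab Pr Pc c mu predT (pred2 IJ.1 IJ.2) predT)
  (antidiag_uniq _ _) _ _ _ A0 B0 t'B).
(* A processor of both slabs would have its coarse column in both pairs. *)
- move=> IJ IJ' h h' ne; apply/pred0P => x /=; apply/negP => /andP[].
  rewrite !inE !andbT => xIJ xIJ'; case/eqP: ne.
  by apply: (antidiag_disjoint (u := tcol mu x) h h'); rewrite ![_ == tcol _ _]eq_sym.
- by move=> IJ /pairP[].
- by move=> IJ /pairP[].
Qed.

End PairCost.

(** * Comparison with the stated bounds *)

Section RealBounds.
Variable R : realType.
Implicit Types x y kappa : R.

Lemma root_le (k : nat) x y : (0 < k)%N -> 0 <= x -> x ^+ k <= y ->
  x <= y `^ k%:R^-1.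
Proof.
move=> k0 x0 xy; have k0' : k%:R != 0 :> R by rewrite pnatr_eq0 -lt0n.
have {1}-> : x = (x ^+ k) `^ k%:R^-1.
  by rewrite -powR_mulrn// -powRrM mulfV// powRr1.
by apply: ge0_ler_powR; rewrite ?nnegrE ?invr_ge0 ?ler0n ?exprn_ge0// (le_trans _ xy)// exprn_ge0.
Qed.

Lemma le_of_expr (k : nat) x y : (0 < k)%N -> 0 < x -> 0 < y ->
  x ^+ k <= y ^+ k -> x <= y.
Proof. by move=> k0 x0 y0; rewrite ler_pXn2r// nnegrE ltW. Qed.

Lemma root_exp (k : nat) y : (0 < k)%N -> 0 <= y -> (y `^ k%:R^-1) ^+ k = y.
Proof.
move=> k0 y0; have k0' : k%:R != 0 :> R by rewrite pnatr_eq0 -lt0n.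
by rewrite -powR_mulrn ?powR_ge0// -powRrM mulVf// powRr1.
Qed.

Lemma ln2_gt0 : 0 < ln 2 :> R.
Proof. by rewrite ln_gt0// ltr1n. Qed.

Lemma log2_ge0 x : 1 <= x -> 0 <= log2 x.
Proof. by move=> x1; apply: divr_ge0 (ltW ln2_gt0); rewrite ln_ge0. Qed.

Lemma le_log2 x y : 0 < x -> x <= y -> log2 x <= log2 y.
Proof.
move=> x0 xy; rewrite ler_pM2r ?invr_gt0 ?ln2_gt0//.
by rewrite ler_ln// posrE// (lt_le_trans x0).
Qed.

(* [ln 0 = 0], so [k = 0] is no exception. *)
Lemma le_log2_nat (k : nat) y : 1 <= y -> k%:R <= y -> log2 k%:R <= log2 y.
Proof.
case: k => [|k] y1 ky; last by apply: le_log2; rewrite ?ltr0n.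
by rewrite {1}/log2 ln0// mul0r; exact: log2_ge0.
Qed.

Lemma log2_nat_ge0 (k : nat) : 0 <= log2 k%:R :> R.
Proof. by case: k => [|k]; [rewrite /log2 ln0// mul0r|apply: log2_ge0; rewrite ler1n]. Qed.

Lemma log2X (k : nat) x : 0 < x -> log2 (x ^+ k) = k%:R * log2 x.
Proof. by move=> x0; rewrite /log2 lnXn// -[ln x *+ k]mulr_natl mulrA. Qed.

(** Applied to the side [s] of the Jacobi grid, it puts the logarithm of [s^2 / 2] above both 1 and
    the logarithm of [s]. *)
Lemma half_sqr_ge x : 2 <= x -> 2 <= x ^+ 2 / 2 /\ x <= x ^+ 2 / 2.
Proof. by move=> x2; split; nra. Qed.

(** A scatter reaches up to [s^2 + 1] processors. With [x = s^2 / 2] this bounds its logarithm by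
    three times that of [s^2 / 2]. *)
Lemma double_lt_cube x : 2 <= x -> 2 * x + 1 <= x ^+ 3.
Proof.
move=> x2; have x4 : 4 <= x ^+ 2 by nra.
rewrite exprS; nra.
Qed.

(** Products of the given square roots are roots of perfect squares. This replaces radicals by
    polynomial relations between integer parameters. *)
Lemma grid_parameters (m n P c pr pc b : R) : 0 < m -> 0 < n -> 0 < P -> 0 < c ->
  pr = Num.sqrt (m * P / (n * c)) -> pc = Num.sqrt (n * P / (m * c)) ->
  b = Num.sqrt (m * n * c / P) ->
  [/\ m = pr * b, n = pc * b & P = pr * pc * c].
Proof.
move=> m0 n0 P0 c0 -> -> ->.
have nz : [&& m != 0, n != 0, P != 0 & c != 0] by apply/and4P; split; rewrite gt_eqF.
have {nz} /and4P[nm nn nP nc] := nz.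
rewrite -!sqrtrM ?divr_ge0 ?mulr_ge0 ?ltW//; split.
- rewrite (_ : _ * (m * n * c / P) = m ^+ 2); last by field; rewrite ?(nn, nc) nP.
  by rewrite sqrtr_sqr ger0_norm ?ltW.
- rewrite (_ : _ * (m * n * c / P) = n ^+ 2); last by field; rewrite ?(nm, nc) nP.
  by rewrite sqrtr_sqr ger0_norm ?ltW.
- rewrite (_ : _ * (n * P / (m * c)) = (P / c) ^+ 2); last by field; rewrite ?(nn, nc, nm).
  by rewrite sqrtr_sqr ger0_norm ?divr_ge0 ?ltW// divfK.
Qed.

(* Q and q count the coarse rows and columns. *)
Section Terms.
Variables (Q q c mu s bh : R).
Hypotheses (Q0 : 0 < Q) (q0 : 0 < q) (c0 : 0 < c) (mu0 : 0 < mu) (s0 : 0 < s)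
  (bh0 : 0 < bh).
Let pr := Q * mu.
Let pc := q * mu.
(** The dependent quantities are solved for: [b] from [s bh = 2 mu b], and [eta] below from
    [s^2 = 2 eta mu c pr]. In the six free variables, [field] can check every identity. *)
Let b := s * bh / (2 * mu).
Let m := pr * b.
Let n := pc * b.
Let P := pr * pc * c.
Let eta := s ^+ 2 / (2 * mu * (c * pr)).
Let X := (eta ^+ 2 * P ^+ 3 / (mu ^+ 2 * c)) `^ 4^-1.

Let nz : [&& Q != 0, q != 0, c != 0, mu != 0, s != 0 & bh != 0].
Proof. by rewrite !lt0r_neq0. Qed.

Let X4 : X ^+ 4 = eta ^+ 2 * P ^+ 3 / (mu ^+ 2 * c).
Proof. by rewrite root_exp// /eta /P /pr /pc ltW// ?(mulr_gt0, invr_gt0, exprn_gt0). Qed.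

Let X_gt0 : 0 < X.
Proof. by rewrite powR_gt0// /eta /P /pr /pc ?(mulr_gt0, invr_gt0, exprn_gt0). Qed.

(** Fourth powers remove the roots: the right side becomes [(q s)^4 / 4], the left [(q s)^4 / 16].
    The factor 1/2 avoids the exact value, the inverse root of 2. *)
Lemma steps_le : q * s / 2 <= X * (n / m) `^ 4^-1.
Proof.
have /and5P[nQ nq nc nmu /andP[ns nbh]] := nz.
have nm0 : 0 < n / m by rewrite /n /m /pr /pc /b !(mulr_gt0, invr_gt0).
apply: (@le_of_expr 4) => //;
  rewrite ?(mulr_gt0, invr_gt0, powR_gt0, sqrtr_gt0, exprn_gt0)//.
rewrite [leRHS]exprMn X4 (root_exp _ (ltW nm0))//.
rewrite (_ : _ * (n / m) = (q * s) ^+ 4 / 4); last first.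
  by rewrite /eta /n /m /P /pr /pc /b; field; rewrite ?(ns, nbh, nq, nmu, nQ, nc).
have : 0 <= (q * s) ^+ 4 by rewrite exprn_ge0// mulr_ge0// ltW.
have -> : (q * s / 2) ^+ 4 = (q * s) ^+ 4 / 16 by field.
by move: (_ ^+ 4) => w w0; lra.
Qed.

Lemma words_le : q * s * bh ^+ 2 / 4 <= (m * n ^+ 7) `^ 4^-1 / X.
Proof.
have /and5P[nQ nq nc nmu /andP[ns nbh]] := nz.
have mn0 : 0 < m * n ^+ 7 by rewrite /n /m /pr /pc /b ?(mulr_gt0, invr_gt0, exprn_gt0).
apply: (@le_of_expr 4) => //;
  rewrite ?(mulr_gt0, invr_gt0, powR_gt0, sqrtr_gt0, exprn_gt0)//.
rewrite [leRHS]expr_div_n X4 (root_exp _ (ltW mn0))//.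
rewrite (_ : _ / (_ / _) = (q * s * bh ^+ 2) ^+ 4 / 64); last first.
  by rewrite /eta /n /m /P /pr /pc /b; field; rewrite ?(ns, nbh, nq, nmu, nQ, nc).
have : 0 <= (q * s * bh ^+ 2) ^+ 4 by rewrite exprn_ge0// !mulr_ge0 ?exprn_ge0// ltW.
have -> : (q * s * bh ^+ 2 / 4) ^+ 4 = (q * s * bh ^+ 2) ^+ 4 / 256 by field.
by move: (_ ^+ 4) => w w0; lra.
Qed.

(** Squaring suffices since only [X^4] is left, and the two squares coincide. *)
Lemma flops_le : q * s * bh ^+ 3 / 4 <= Num.sqrt (m * n ^+ 5) / X ^+ 2.
Proof.
have /and5P[nQ nq nc nmu /andP[ns nbh]] := nz.
have mn0 : 0 < m * n ^+ 5 by rewrite /n /m /pr /pc /b ?(mulr_gt0, invr_gt0, exprn_gt0).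
apply: (@le_of_expr 2) => //;
  rewrite ?(mulr_gt0, invr_gt0, powR_gt0, sqrtr_gt0, exprn_gt0)//.
rewrite [leRHS]expr_div_n -exprM X4 (sqr_sqrtr (ltW mn0)).
rewrite (_ : _ / (_ / _) = (q * s * bh ^+ 3 / 4) ^+ 2)//.
by rewrite /eta /n /m /P /pr /pc /b; field; rewrite ?(ns, nbh, nq, nmu, nQ, nc).
Qed.

Lemma matmul_words : Num.sqrt (m * n ^+ 3 / (c * P)) = q * (mu * b ^+ 2 / c).
Proof.
have /and5P[nQ nq nc nmu /andP[ns nbh]] := nz.
rewrite (_ : _ / _ = (q * (mu * b ^+ 2 / c)) ^+ 2); last first.
  by rewrite /n /m /P /pr /pc /b; field; rewrite ?(nq, nmu, nQ, nc).
rewrite sqrtr_sqr ger0_norm// /b ltW// ?(mulr_gt0, invr_gt0, exprn_gt0)//.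
Qed.

Lemma matmul_flops : m * n ^+ 2 / P = q * (mu * b ^+ 3 / c).
Proof.
have /and5P[nQ nq nc nmu /andP[ns nbh]] := nz.
by rewrite /n /m /P /pr /pc /b; field; rewrite ?(nq, nmu, nQ, nc).
Qed.

End Terms.

(** The common end of the three comparisons: [1152 = 96 * 12] and [4608 = 144 * 32]. The 32 is what
    flops require, a factor 8 in [a] against the 1/4 of [flops_le]. *)
Lemma total_cost_le (a d T U kappa : R) (s q k : nat) :
  0 <= kappa -> 0 <= T ->
  U <= (d *+ 96 + a *+ 144 *+ s *+ k) *+ q ->
  q%:R * d <= 12 * kappa * T -> q%:R * s%:R * a <= 32 * kappa * T ->
  U <= kappa * (1152 + 4608 * k%:R) * T.
Proof.
move=> kap0 T0 UT qd qsa; apply: le_trans UT _.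
have -> : (d *+ 96 + a *+ 144 *+ s *+ k) *+ q =
    96 * (q%:R * d) + 144 * k%:R * (q%:R * s%:R * a) by ring.
have -> : kappa * (1152 + 4608 * k%:R) * T =
    96 * (12 * kappa * T) + 144 * k%:R * (32 * kappa * T) by ring.
by apply: lerD; apply: ler_wpM2l => //; rewrite mulr_ge0.
Qed.

End RealBounds.

(** * The bounds on messages, words and flops of one sweep *)

Theorem theorem5 (R : realType) (kappa : R) (max_sweeps : nat) :
  exists2 C : R, 0 < C &
  forall (M : cost_model R) (m n P c mu Pr Pc b s bh : nat) (eta : R)
         (place : nat -> nat -> nat -> nat -> proc Pr Pc c)
         (sweeps : nat -> nat -> nat),
  cost_model_bounded kappa M ->
  (n <= m)%N ->
  (1 <= c)%N -> c%:R <= (n%:R / m%:R * P%:R : R) `^ 3^-1 ->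
  (c <= mu)%N -> mu%:R <= Num.sqrt (n%:R * P%:R / (m%:R * c%:R) : R) ->
  2 * mu%:R / Num.sqrt (m%:R * c%:R * P%:R / n%:R) <= eta -> eta <= 1 ->
  (* integrality of the grid dimensions, block sizes and numbers of groups *)
  Pr%:R = Num.sqrt (m%:R * P%:R / (n%:R * c%:R)) :> R ->
  Pc%:R = Num.sqrt (n%:R * P%:R / (m%:R * c%:R)) :> R ->
  b%:R = Num.sqrt (m%:R * n%:R * c%:R / P%:R) :> R ->
  (mu %| Pr)%N -> (mu %| Pc)%N ->
  (* 2D grid of each subproblem: s x s processors, bh x bh blocks, order 2 B *)
  s%:R ^+ 2 = 2 * eta * mu%:R * Num.sqrt (m%:R * c%:R * P%:R / n%:R) ->
  (s * bh = 2 * (mu * b))%N ->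
  placement mu s place ->
  (forall I J, (sweeps I J <= max_sweeps)%N) ->
  let m' : R := m%:R in let n' : R := n%:R in let P' : R := P%:R in
  let c' : R := c%:R in let mu' : R := mu%:R in
  let X := (eta ^+ 2 * P' ^+ 3 / (mu' ^+ 2 * c')) `^ 4^-1 in
  let t := jacobi_svd_sweep M mu b s bh place sweeps in
  [/\ critical_path (@msgs R) t <=
        C * (X * (n' / m') `^ 4^-1 * log2 (eta * mu' * Num.sqrt (m' * c' * P' / n'))
             + Num.sqrt (m' * P' / (n' * c')) / mu'
               * log2 (Num.sqrt (m' * P' / (n' * c')) / mu')),
      critical_path (@words R) t <=
        C * ((m' * n' ^+ 7) `^ 4^-1 / X + Num.sqrt (m' * n' ^+ 3 / (c' * P'))) &
      critical_path (@flops R) t <=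
        C * (Num.sqrt (m' * n' ^+ 5) / X ^+ 2 + m' * n' ^+ 2 / P')].
Proof.
(* A constant of at least 1 also absorbs the collectives, whose costs are explicit and not scaled by
   [kappa]. *)
pose kap : R := Num.max 1 kappa.
have kap1 : 1 <= kap by rewrite le_max lexx.
have kapE : kappa <= kap by rewrite le_max lexx orbT.
have kap0 : 0 <= kap by apply: le_trans kap1.
have kap_mono x : 0 <= x -> kappa * x <= kap * x by move=> x0; rewrite ler_wpM2r.
exists (kap * (1152 + 4608 * max_sweeps%:R)).
  apply: mulr_gt0; first exact: lt_le_trans kap1.
  by have := ler0n R max_sweeps; lra.
move=> M m n P c mu Pr Pc b s bh eta place sweeps [p2pm p2pw mm gemm_k eig_k].
move=> nm c1 cle cmu mule etale eta1 PrE PcE bE dPr dPc s2 sbh placed swle.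
move=> m' n' P' c' mu' X t.
have c0 : 0 < c%:R :> R by rewrite ltr0n.
have mu1 : (0 < mu)%N by exact: leq_trans cmu.
have mu0 : 0 < mu%:R :> R by rewrite ltr0n.
(* If one of [n], [m], [P] were 0, the bound on [c] would read [c <= 0]; the inverse of 0 is 0. *)
have : n' / m' * P' != 0.
  apply: contraTneq cle => ->; rewrite powR0 ?invr_eq0 ?pnatr_eq0// -ltNge //.
rewrite !mulf_eq0 invr_eq0 !negb_or => /andP[/andP[nn0 nm0] nP0].
have n0 : 0 < n' by rewrite lt0r nn0 ler0n.
have m0 : 0 < m' by rewrite lt0r nm0 ler0n.
have P0 : 0 < P' by rewrite lt0r nP0 ler0n.
have [mE nE PE] := grid_parameters m0 n0 P0 c0 PrE PcE bE.
have Pr0 : 0 < Pr%:R :> R by rewrite PrE sqrtr_gt0 ?(mulr_gt0, invr_gt0).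
have Pc0 : 0 < Pc%:R :> R by rewrite PcE sqrtr_gt0 ?(mulr_gt0, invr_gt0).
have b0 : 0 < b%:R :> R by rewrite bE sqrtr_gt0 ?(mulr_gt0, invr_gt0).
pose Q := (Pr %/ mu)%N; pose q := (Pc %/ mu)%N.
have PrQ : Pr%:R = Q%:R * mu%:R :> R by rewrite -natrM divnK.
have Pcq : Pc%:R = q%:R * mu%:R :> R by rewrite -natrM divnK.
have Q0 : 0 < Q%:R :> R by move: Pr0; rewrite PrQ pmulr_lgt0.
have q0 : 0 < q%:R :> R by move: Pc0; rewrite Pcq pmulr_lgt0.
(* Here [n <= m] enters: each of the [q] groups pays a logarithm of [Q] for its column collectives,
   and the statement allows [Q] of them. *)
have qQ : q%:R <= Q%:R :> R.
  have : n' <= m' by rewrite ler_nat.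
  by rewrite nE mE ler_pM2r// PrQ Pcq ler_pM2r.
have slabE : Num.sqrt (m' * c' * P' / n') = c' * Pr%:R.
  rewrite (_ : _ / _ = (c' * Pr%:R) ^+ 2).
    by rewrite sqrtr_sqr ger0_norm// mulr_ge0// ltW.
  by rewrite PE mE nE; field; rewrite !gt_eqF.
have slab0 : 0 < c' * Pr%:R by rewrite mulr_gt0.
rewrite slabE in etale s2.
have eta0 : 0 < eta by apply: lt_le_trans etale; rewrite ?(mulr_gt0, invr_gt0).
have s0 : 0 < s%:R :> R.
  have : s%:R ^+ 2 != 0 :> R by rewrite s2 gt_eqF// !mulr_gt0.
  by rewrite sqrf_eq0 lt0r ler0n andbT.
have sbhR : s%:R * bh%:R = 2 * (mu%:R * b%:R) :> R by rewrite -!natrM sbh.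
have bh0 : 0 < bh%:R :> R by rewrite -(pmulr_rgt0 _ s0) sbhR !mulr_gt0.
have bR : b%:R = s%:R * bh%:R / (2 * mu%:R) :> R.
  by rewrite sbhR; field; rewrite gt_eqF.
have etaE : eta = s%:R ^+ 2 / (2 * mu%:R * (c%:R * Pr%:R)).
  by rewrite s2; field; rewrite !gt_eqF.
(* The lower limit on [eta] says exactly this. With [s bh = 2 mu b] it makes a Jacobi block no
   larger than a fine tile. *)
have s_ge : 2 * mu%:R <= s%:R :> R.
  apply: (@le_of_expr _ 2) => //; first by rewrite mulr_gt0.
  rewrite s2; move: etale; rewrite ler_pdivrMr// => h.
  have := ler_wpM2l (mulr_ge0 (ler0n _ 2) (ltW mu0)) h.
  by rewrite (_ : (2 * _) ^+ 2 = 2 * mu%:R * (2 * mu%:R)) ?(expr2, mulrA)//; lra.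
have s_gen : (2 * mu <= s)%N by rewrite -(ler_nat R) natrM.
have bh_le : (bh <= b)%N.
  rewrite -(leq_pmul2l (_ : 0 < 2 * mu)%N) ?muln_gt0//.
  by rewrite -[leqRHS]mulnA -sbh leq_mul2r s_gen orbT.
(* The two logarithms of the statement, as [eta mu c Pr = s^2 / 2] and [Pr / mu = Q]. *)
pose L := log2 (s%:R ^+ 2 / 2 : R); pose D := log2 (Q%:R : R).
have s_ge2 : (2 <= s)%N by apply: leq_trans s_gen; rewrite leq_pmulr.
have [s2_ge2 s_le] : 2 <= s%:R ^+ 2 / 2 :> R /\ s%:R <= s%:R ^+ 2 / 2 :> R.
  by apply: half_sqr_ge; rewrite ler_nat.
have s2_ge1 : 1 <= s%:R ^+ 2 / 2 :> R by apply: le_trans s2_ge2; rewrite ler1n.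
(* Lets the bounded message counts of point-to-point sends be absorbed by [L]. *)
have L1 : 1 <= L.
  have <- : log2 2 = 1 :> R by rewrite /log2 divff// gt_eqF// ln2_gt0.
  exact: le_log2.
have D0 : 0 <= D by exact: log2_nat_ge0.
have LE : log2 (eta * mu' * (c' * Pr%:R)) = L.
  by rewrite /L s2; congr log2; field.
have sL : s%:R <= s%:R * L by rewrite ler_peMr ?ler0n.
have LsL : L <= s%:R * L by rewrite ler_peMl ?(le_trans _ L1)// ler1n ltnW.
have logs (k : nat) : (k <= s)%N -> log2 (k%:R : R) <= L.
  move=> ks; apply: le_log2_nat => //.
  by apply: le_trans s_le; rewrite ler_nat.
have logs2 (k : nat) : (k <= (s ^ 2).+1)%N -> log2 (k%:R : R) <= 3 * L.
  move=> ks; rewrite -log2X; last exact: lt_le_trans s2_ge1.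
  apply: le_log2_nat; first exact: exprn_ege1.
  apply: (@le_trans _ _ (s ^ 2).+1%:R); first by rewrite ler_nat.
  apply: le_trans (double_lt_cube s2_ge2).
  by rewrite -natr1 natrX mulrC divfK// pnatr_eq0.
have logQ (k : nat) : (k <= Q)%N -> log2 (k%:R : R) <= D.
  by move=> kQ; apply: le_log2_nat; rewrite ?ler_nat// ler1n -(ltr0n R).
have [mmM mmW mmF] : [/\ msgs (mm25 M (mu * b) mu c) <= kap * (mu%:R / c%:R + log2 c%:R),
    words (mm25 M (mu * b) mu c) <= kap * (mu%:R * b%:R ^+ 2 / c%:R) &
    flops (mm25 M (mu * b) mu c) <= kap * (mu%:R * b%:R ^+ 3 / c%:R)].
  have pE : (mu ^ 2 * c)%:R = mu%:R ^+ 2 * c%:R :> R by rewrite natrM natrX.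
  (* After cubing, [c^3 <= mu^2 c] follows from [c <= mu]: replication [c] is admissible on a
     [mu x mu x c] grid. *)
  have croot : c%:R <= (mu ^ 2 * c)%:R `^ 3^-1 :> R.
    apply: root_le; rewrite ?ler0n// -natrX ler_nat expnSr leq_mul2r.
    by rewrite leq_exp2r// cmu orbT.
  have [mmM mmW mmF] := mm (mu * b)%N mu c c1 croot.
  split; [move: mmM|move: mmW|move: mmF]; rewrite pE ?natrM => /le_trans; apply.
  - rewrite (_ : _ / c%:R ^+ 3 = (mu%:R / c%:R) ^+ 2); last by field; rewrite gt_eqF.
    rewrite sqrtr_sqr ger0_norm ?divr_ge0//; apply: kap_mono.
    by apply: addr_ge0; [rewrite divr_ge0|exact: log2_nat_ge0].
  - rewrite (_ : c%:R * _ = (mu%:R * c%:R) ^+ 2); last by ring.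
    rewrite sqrtr_sqr ger0_norm ?mulr_ge0//.
    rewrite (_ : _ / _ = mu%:R * b%:R ^+ 2 / c%:R); last by field; rewrite !gt_eqF.
    by rewrite kap_mono// divr_ge0// mulr_ge0.
  - rewrite (_ : _ / (_ * _) = mu%:R * b%:R ^+ 3 / c%:R); last by field; rewrite !gt_eqF.
    by rewrite kap_mono// divr_ge0// mulr_ge0.
(* The Cannon steps of one product do not outnumber the groups of one Jacobi sweep. *)
have mu_c : mu%:R / c%:R <= s%:R :> R.
  rewrite ler_pdivrMr//; apply: (@le_trans _ _ s%:R).
    by apply: le_trans s_ge; rewrite ler_peMl ?ler0n ?ler1n.
  by rewrite ler_peMr ?ler0n ?ler1n.
have [T1 T2 T3] : [/\ q%:R * s%:R / 2 <= X * (n' / m') `^ 4^-1,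
    q%:R * s%:R * bh%:R ^+ 2 / 4 <= (m' * n' ^+ 7) `^ 4^-1 / X &
    q%:R * s%:R * bh%:R ^+ 3 / 4 <= Num.sqrt (m' * n' ^+ 5) / X ^+ 2].
  have := flops_le Q0 q0 c0 mu0 s0 bh0.
  have := words_le Q0 q0 c0 mu0 s0 bh0.
  have := steps_le Q0 q0 c0 mu0 s0 bh0.
  by rewrite -!bR -!PrQ -!Pcq -!mE -!nE -!PE -!etaE.
have [T4 T5] : Num.sqrt (m' * n' ^+ 3 / (c' * P')) = q%:R * (mu%:R * b%:R ^+ 2 / c%:R) /\
    m' * n' ^+ 2 / P' = q%:R * (mu%:R * b%:R ^+ 3 / c%:R).
  have := matmul_words Q0 q0 c0 mu0 s0 bh0.
  have := matmul_flops Q0 q0 c0 mu0 s0 bh0.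
  by rewrite -!bR -!PrQ -!Pcq -!mE -!nE -!PE.
rewrite slabE LE -PrE PrQ mulfK ?gt_eqF// -/D T4 T5.
have L0 : 0 <= L by exact: le_trans L1.
clearbody L D.
have qsL0 : 0 <= q%:R * (s%:R * L) by rewrite !mulr_ge0.
have qD : q%:R * D <= Q%:R * D := ler_wpM2r D0 qQ.
have kap_scale x y : x <= y -> kap * x <= kap * y by exact: ler_wpM2l.
have kap_absorb x : 0 <= x -> x <= kap * x by move=> x0; rewrite ler_peMl.
have kapw (x : nat) : kappa * x%:R <= kap * x%:R by rewrite kap_mono.
have bh3 : 0 <= bh%:R ^+ 3 :> R by rewrite exprn_ge0.
have bh2 : 0 <= bh%:R ^+ 2 :> R by rewrite exprn_ge0.
have b1 : 1 <= b%:R :> R by rewrite ler1n -(ltr0n R).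
have muc1 : 1 <= mu%:R / c%:R :> R by rewrite ler_pdivlMr// mul1r ler_nat.
have b_gt0 : (0 < b)%N by rewrite -(ltr0n R).
have bh_ge1 : 1 <= bh%:R :> R by rewrite ler1n -(ltr0n R).
(* As [c <= mu], moving a fine tile is within the words of a 2.5D product; with [b >= 1], adding one
   is within its flops. *)
have b2_le : b%:R ^+ 2 <= mu%:R * b%:R ^+ 2 / c%:R :> R.
  by rewrite mulrAC ler_peMl// exprn_ge0.
have b2_le3 : b%:R ^+ 2 <= mu%:R * b%:R ^+ 3 / c%:R :> R.
  apply: (@le_trans _ _ (b%:R ^+ 3)); first exact: ler_weXn2l.
  by rewrite mulrAC ler_peMl// exprn_ge0.
split.
- set T := X * _ * _ + _.
  have TE : q%:R * (s%:R * L) / 2 + Q%:R * D <= T.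
    rewrite lerD2r; have := ler_wpM2r L0 T1.
    by apply: le_trans; lra.
  (* In a Jacobi sweep the worst is a broadcast along a grid line, [2 L]. Outside, [3 s L] covers a
     scatter or a product, and [2 D] a collective along a coarse column. *)
  apply: (@total_cost_le _ (2 * (kap * L)) (kap * (3 * (s%:R * L) + 2 * D)) _ _ _ s q) => //.
  + apply: le_trans TE; rewrite addr_ge0 ?mulr_ge0// divr_ge0//.
  + have kL : kap <= kap * L by rewrite ler_peMr.
    have d_ge x : x <= 3 * (s%:R * L) + 2 * D -> kap * x <= kap * (3 * (s%:R * L) + 2 * D).
      exact: kap_scale.
    have d_ge' x : 0 <= x -> x <= 3 * (s%:R * L) + 2 * D -> x <= kap * (3 * (s%:R * L) + 2 * D).
      by move=> x0 xd; apply: le_trans (kap_absorb _ x0) _; exact: d_ge.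
    have sL0 : 0 <= s%:R * L by rewrite mulr_ge0.
    have a0 : 0 <= kap * L by rewrite mulr_ge0.
    have d0 : 0 <= kap * (3 * (s%:R * L) + 2 * D) by rewrite mulr_ge0// addr_ge0// mulr_ge0.
    have a_ge : kap <= 2 * (kap * L) by lra.
    have d1 : kap <= kap * (3 * (s%:R * L) + 2 * D).
      by rewrite -[leLHS]mulr1; apply: d_ge; lra.
    apply: jacobi_svd_sweep_critical_path placed swle => //=.
    * exact: mulr_ge0.
    * exact: le_trans (le_trans (p2pm _) kapE) a_ge.
    * exact: le_trans (le_trans (p2pm _) kapE) a_ge.
    * exact: mulr_ge0.
    * exact: mulr_ge0.
    * move=> A sA; rewrite ler_wpM2l//; apply: le_trans (logs _ sA) _.
      exact: kap_absorb.
    * exact: le_trans (le_trans (p2pm _) kapE) d1.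
    * apply: le_trans mmM _; apply: d_ge; have := logs c (leq_trans cmu (leq_trans _ s_gen)).
      by rewrite leq_pmull// => /(_ isT); lra.
    * move=> A QA; apply: d_ge'; first by rewrite mulr_ge0 ?log2_nat_ge0.
      by have := logQ _ QA; lra.
    * move=> A QA; apply: d_ge'; first by rewrite mulr_ge0 ?log2_nat_ge0.
      by have := logQ _ QA; lra.
    * move=> A sA; apply: d_ge'; first exact: log2_nat_ge0.
      by have := logs2 _ sA; lra.
  + rewrite mulrCA [leRHS]mulrAC [leRHS]mulrC; apply: kap_scale.
    apply: le_trans (_ : 12 * (q%:R * (s%:R * L) / 2 + Q%:R * D) <= _).
      have : 0 <= Q%:R * D by rewrite mulr_ge0.
      by rewrite mulrDr; lra.
    by rewrite ler_wpM2l.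
  + rewrite (_ : _ * _ * _ = kap * (2 * (q%:R * (s%:R * L)))); last by ring.
    rewrite [leRHS]mulrAC [leRHS]mulrC; apply: kap_scale.
    have : 0 <= Q%:R * D by rewrite mulr_ge0.
    by lra.
- set T := _ / X + _.
  have T0 : 0 <= q%:R * (mu%:R * b%:R ^+ 2 / c%:R) :> R by rewrite !mulr_ge0 ?invr_ge0 ?exprn_ge0.
  have TE : q%:R * s%:R * bh%:R ^+ 2 / 4 + q%:R * (mu%:R * b%:R ^+ 2 / c%:R) <= T.
    by rewrite lerD2r.
  have T0' : 0 <= q%:R * s%:R * bh%:R ^+ 2 :> R by rewrite !mulr_ge0.
  have w0 : 0 <= mu%:R * b%:R ^+ 2 / c%:R :> R by rewrite !mulr_ge0 ?invr_ge0 ?exprn_ge0.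
  (* Both factors 4 come from broadcasting two blocks at twice the volume. *)
  apply: (@total_cost_le _ (kap * (4 * bh%:R ^+ 2))
    (kap * (4 * (mu%:R * b%:R ^+ 2 / c%:R))) _ _ _ s q) => //.
  + by apply: le_trans TE; rewrite addr_ge0// divr_ge0.
  + have send_bh (k : nat) : (k <= 4)%N ->
        p2p_words M (k * bh ^ 2) <= kap * (4 * bh%:R ^+ 2).
      move=> k4; apply: le_trans (p2pw _) _; apply: le_trans (kapw _) _.
      by rewrite kap_scale// natrM natrX ler_wpM2r// ler_nat.
    have a0 : 0 <= kap * (4 * bh%:R ^+ 2) by rewrite !mulr_ge0.
    have d0 : 0 <= kap * (4 * (mu%:R * b%:R ^+ 2 / c%:R)) by rewrite mulr_ge0// mulr_ge0.
    have coll (k : R) : 0 <= k -> k <= 4 -> k * b%:R ^+ 2 <= kap * (4 * (mu%:R * b%:R ^+ 2 / c%:R)).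
      move=> k0 k4; apply: (@le_trans _ _ (4 * (mu%:R * b%:R ^+ 2 / c%:R))).
        by apply: ler_pM => //; rewrite exprn_ge0.
      by apply: kap_absorb; rewrite mulr_ge0.
    apply: jacobi_svd_sweep_critical_path placed swle => //=.
    * by have := send_bh 1%N isT; rewrite mul1n.
    * exact: send_bh.
    * move=> A _; apply: le_trans (_ : 4 * bh%:R ^+ 2 <= _); last first.
        by apply: kap_absorb; rewrite mulr_ge0.
      by rewrite natrM natrX mulrA -natrM.
    * apply: le_trans (p2pw _) _; apply: le_trans (kapw _) _; rewrite kap_scale// natrX.
      by lra.
    * by apply: le_trans mmW _; rewrite kap_scale//; lra.
    * by move=> A _; rewrite natrX; apply: coll; rewrite ?ler_nat.
    * by move=> A _; rewrite natrM natrX mulrA -natrM; apply: coll; rewrite ?ler_nat.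
    * by move=> A _; rewrite natrX -[leLHS]mul1r; apply: coll; rewrite ?ler1n.
  + rewrite mulrCA [leRHS]mulrAC [leRHS]mulrC; apply: kap_scale.
    by move: TE; lra.
  + rewrite (_ : _ * _ * _ = kap * (4 * (q%:R * s%:R * bh%:R ^+ 2))); last by ring.
    by rewrite [leRHS]mulrAC [leRHS]mulrC; apply: kap_scale; lra.
- set T := _ / X ^+ 2 + _.
  have T0 : 0 <= q%:R * (mu%:R * b%:R ^+ 3 / c%:R) :> R by rewrite !mulr_ge0 ?invr_ge0 ?exprn_ge0.
  have TE : q%:R * s%:R * bh%:R ^+ 3 / 4 + q%:R * (mu%:R * b%:R ^+ 3 / c%:R) <= T.
    by rewrite lerD2r.
  have T0' : 0 <= q%:R * s%:R * bh%:R ^+ 3 :> R by rewrite !mulr_ge0.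
  have w0 : 0 <= mu%:R * b%:R ^+ 3 / c%:R :> R by rewrite !mulr_ge0 ?invr_ge0 ?exprn_ge0.
  (* The 8 comes from diagonalizing a matrix of order [2 bh]. *)
  apply: (@total_cost_le _ (kap * (8 * bh%:R ^+ 3))
    (kap * (2 * (mu%:R * b%:R ^+ 3 / c%:R))) _ _ _ s q) => //.
  + by apply: le_trans TE; rewrite addr_ge0// divr_ge0.
  + have a0 : 0 <= kap * (8 * bh%:R ^+ 3) by rewrite !mulr_ge0.
    have d0 : 0 <= kap * (2 * (mu%:R * b%:R ^+ 3 / c%:R)) by rewrite mulr_ge0// mulr_ge0.
    have sum_le : (b ^ 2)%:R <= kap * (2 * (mu%:R * b%:R ^+ 3 / c%:R)).
      rewrite natrX; apply: le_trans (_ : 2 * (mu%:R * b%:R ^+ 3 / c%:R) <= _); first lra.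
      by apply: kap_absorb; rewrite mulr_ge0.
    apply: jacobi_svd_sweep_critical_path placed swle => //=.
    * apply: le_trans (eig_k _) _; apply: (@le_trans _ _ (kap * (2 * bh)%:R ^+ 3)).
        by rewrite kap_mono// exprn_ge0.
      by rewrite kap_scale// natrM exprMn ler_wpM2r// -natrX ler_nat.
    * have h1 : gemm M bh <= kap * bh%:R ^+ 3 by rewrite (le_trans (gemm_k _))// kap_mono.
      have h2 : (bh ^ 2)%:R <= kap * bh%:R ^+ 3.
        apply: le_trans (kap_absorb _ bh3); rewrite natrX; exact: ler_weXn2l.
      have h3 : 0 <= kap * bh%:R ^+ 3 by rewrite mulr_ge0.
      by lra.
    * by apply: le_trans mmF _; rewrite kap_scale//; lra.
  + rewrite mulrCA [leRHS]mulrAC [leRHS]mulrC; apply: kap_scale.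
    by move: TE; lra.
  + rewrite (_ : _ * _ * _ = kap * (8 * (q%:R * s%:R * bh%:R ^+ 3))); last by ring.
    by rewrite [leRHS]mulrAC [leRHS]mulrC; apply: kap_scale; lra.
Qed.
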